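(* Let $K\subset\mathbb{R}^n$ be a generalized Orlicz ball, let $(a_i)_{i=1}^n$ be a sequence of reals, and let $X_1,\dots,X_n$ be the coordinates of a random vector uniformly distributed on $K$. Let $X_1^\star,\dots,X_n^\star$ be independent random variables such that, for each $i$, $X_i^\star$ has the same distribution as $X_i$. Then for any even positive integer $p$, $$\mathbb{E}\Big(\sum_{i=1}^n a_iX_i\Big)^p\le\mathbb{E}\Big(\sum_{i=1}^n a_iX_i^\star\Big)^p.$$
   Context: A function $f:[0,\infty)\to[0,\infty]$ is a Young function if it is convex, $f(0)=0$, $f(x)\neq 0$ for some $x$, and $f(x)\neq\infty$ for some $x\neq 0$. Given $n$ Young functions $f_1,\dots,f_n$, the set $K=\{(x_1,\dots,x_n)\in\mathbb{R}^n:\sum_{i=1}^n f_i(|x_i|)\le 1\}$ is called a generalized Orlicz ball. Uniform distribution on $K$ means normalized Lebesgue measure on $K$. *)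

(* Defs.v *)
From HB Require Import structures.
From mathcomp Require Import all_boot all_order all_algebra.
From mathcomp Require Import all_classical all_reals all_analysis.

Set Implicit Arguments.
Unset Strict Implicit.
Unset Printing Implicit Defensive.

Import Order.TTheory GRing.Theory Num.Theory.
Import numFieldNormedType.Exports.

Local Open Scope classical_set_scope.
Local Open Scope ring_scope.
Local Open Scope ereal_scope.

(* A function [0, +oo[ -> [0, +oo] is represented by f : R -> \bar R, whose
   values at negative reals are irrelevant. In the convexity inequality,
   0 * +oo = 0. *)
Record young_function (R : realType) (f : R -> \bar R) : Prop := YoungFunction {
  young_ge0 : forall x : R, (0 <= x)%R -> 0 <= f x ;
  young_convex : forall x y t : R, (0 <= x)%R -> (0 <= y)%R -> (0 <= t <= 1)%R ->
    f (t * x + (1 - t) * y)%R <= t%:E * f x + (1 - t)%:E * f y ;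
  young0 : f 0%R = 0 ;
  young_neq0 : exists2 x : R, (0 <= x)%R & f x != 0 ;
  young_neqy : exists2 x : R, (0 < x)%R & f x != +oo }.

Definition orlicz_ball (R : realType) (n : nat) (f : 'I_n -> R -> \bar R) :
    set (n.-tuple R) :=
  [set x | \sum_(i < n) f i `|tnth x i|%R <= 1].

Definition generalized_orlicz_ball (R : realType) (n : nat)
    (K : set (n.-tuple R)) : Prop :=
  exists2 f : 'I_n -> R -> \bar R,
    (forall i, young_function (f i)) & K = orlicz_ball f.

Definition tcons (T : Type) (n : nat) (xt : T * n.-tuple T) : n.+1.-tuple T :=
  [tuple of xt.1 :: xt.2].

(* Lebesgue measure on the Borel sets of R^n, as an iterated product measure. *)
Fixpoint lebesgue_tuple (R : realType) (n : nat) : set (n.-tuple R) -> \bar R :=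
  match n with
  | 0 => \d_[tuple]
  | m.+1 => pushforward (@lebesgue_measure R \x @lebesgue_tuple R m) (@tcons R m)
  end.

Section lebesgue_tuple_measure.
Variable R : realType.

(* For non-finite measures, canonical inference does not find the library's
   sigma-finite structure on m \x m'. *)
Let sigma_finite_product (d d' : measure_display) (T : measurableType d)
    (T' : measurableType d') (m : {sigma_finite_measure set T -> \bar R})
    (m' : {sigma_finite_measure set T' -> \bar R}) :
  sigma_finite setT (m \x m').
Proof.
have /sigma_finiteP[F [TF ndF Foo]] := sigma_finiteT m.
have /sigma_finiteP[G [TG ndG Goo]] := sigma_finiteT m'.
exists (fun k => F k `*` G k).
  rewrite -setXTT TF TG; apply/seteqP; split => -[x y] /=.
    move=> [[i _ Fix] [j _ Gjy]]; exists (maxn i j) => //; split.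
      by move: x Fix; exact/subsetPset/ndF/leq_maxl.
    by move: y Gjy; exact/subsetPset/ndG/leq_maxr.
  by move=> [k _ []/= ? ?]; split; exists k.
move=> k; have [mF muF] := Foo k; have [mG muG] := Goo k.
split; first exact: measurableX.
by rewrite product_measure1E// lte_mul_pinfty// ge0_fin_numE.
Qed.

Let sigma_finite_pushforward (d d' : measure_display) (T : measurableType d)
    (T' : measurableType d') (m : set T -> \bar R)
    (f : T -> T') (g : T' -> T) :
  sigma_finite setT m -> measurable_fun setT g -> cancel f g ->
  sigma_finite setT (pushforward m f).
Proof.
move=> [F UF Ffin] mg fK.
exists (fun k => g @^-1` F k).
  by rewrite -preimage_bigcup -UF preimage_setT.
move=> k; have [mF muF] := Ffin k; split.
  by rewrite -[X in measurable X]setTI; exact: mg.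
rewrite /pushforward (_ : _ @^-1` _ = F k)//.
by apply/seteqP; split => x /=; rewrite fK.
Qed.

Let sigma_finite_measureP (d d' : measure_display) (T : measurableType d)
    (T' : measurableType d') (m : {measure set T -> \bar R}) (f : T -> T') :
  measurable_fun setT f -> sigma_finite setT (pushforward m f) ->
  exists nu : {sigma_finite_measure set T' -> \bar R}, pushforward m f = nu.
Proof.
move=> mf sf.
pose nu : {measure set T' -> \bar R} :=
  measure_function_pushforward__canonical__measure_function_Measure m mf.
pose nuS := Measure_isSigmaFinite.Build _ _ _ nu sf.
pose nu' : {sigma_finite_measure set T' -> \bar R} :=
  HB.pack (Measure.sort nu) nuS.
by exists nu'.
Qed.

Let lebesgue_tuple_sigma_finite_measure (n : nat) :
  exists mu : {sigma_finite_measure set (n.-tuple R) -> \bar R},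
    @lebesgue_tuple R n = mu.
Proof.
elim: n => [|n [mu muE]].
  by exists (\d_([tuple] : 0.-tuple R)).
pose g (t : n.+1.-tuple R) := (thead t, [tuple of behead t] : n.-tuple R).
have mg : measurable_fun setT
    (g : n.+1.-tuple R -> measurableTypeR R * n.-tuple R).
  apply/measurable_fun_pair => /=; first exact: measurable_tnth.
  exact: measurable_behead.
have fK : cancel (@tcons R n) g.
  by move=> [x t]; rewrite /g /tcons/= theadE; congr pair; exact/val_inj.
have mf : measurable_fun setT
    (@tcons R n : measurableTypeR R * n.-tuple R -> n.+1.-tuple R).
  exact: measurable_cons.
have nu_sf := sigma_finite_pushforward (sigma_finite_product lebesgue_measure mu)
  mg fK.
have [nu nuE] := sigma_finite_measureP mf nu_sf.
by exists nu; rewrite -nuE /= muE.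
Qed.

Variable n : nat.

Let lebesgue_tuple0 : @lebesgue_tuple R n set0 = 0.
Proof. by have [mu ->] := lebesgue_tuple_sigma_finite_measure n. Qed.

Let lebesgue_tuple_ge0 A : 0 <= @lebesgue_tuple R n A.
Proof. by have [mu ->] := lebesgue_tuple_sigma_finite_measure n. Qed.

Let lebesgue_tuple_sigma_additive : semi_sigma_additive (@lebesgue_tuple R n).
Proof.
have [mu ->] := lebesgue_tuple_sigma_finite_measure n.
exact: measure_semi_sigma_additive.
Qed.

HB.instance Definition _ := isMeasure.Build _ _ _ (@lebesgue_tuple R n)
  lebesgue_tuple0 lebesgue_tuple_ge0 lebesgue_tuple_sigma_additive.

Let lebesgue_tuple_sigma_finite : sigma_finite setT (@lebesgue_tuple R n).
Proof.
have [mu ->] := lebesgue_tuple_sigma_finite_measure n.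
exact: sigma_finiteT.
Qed.

HB.instance Definition _ := Measure_isSigmaFinite.Build _ _ _
  (@lebesgue_tuple R n) lebesgue_tuple_sigma_finite.

End lebesgue_tuple_measure.

Lemma lebesgue_tuple_box (R : realType) (n : nat) (B : 'I_n -> set R) :
  (forall i, measurable (B i)) ->
  lebesgue_tuple [set x : n.-tuple R | forall i, B i (tnth x i)] =
  \prod_(i < n) lebesgue_measure (B i).
Proof.
elim: n B => [|n IH] B mB.
  rewrite big_ord0 /= diracE mem_set//=; first by case.
rewrite big_ord_recl -IH//= /pushforward.
rewrite -product_measure1E//; last first.
  rewrite (_ : mkset _ =
    \bigcap_(i in [set: 'I_n]) ((@tnth n R)^~ i @^-1` B (lift ord0 i))); last first.
    by apply/seteqP; split => [x xB i _|x xB i]; [exact: xB|exact: (xB i)].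
  apply: fin_bigcap_measurable => // i _.
  rewrite -[X in measurable X]setTI; exact: measurable_tnth.
  exact: mB.
congr (product_measure1 _ _ _); apply/seteqP; split => -[x t] /=.
  move=> xtB; split; first exact: (xtB ord0).
  by move=> i; have := xtB (lift ord0 i); rewrite tnthS.
move=> [xB tB] i; case: (unliftP ord0 i) => [j ->|->//].
by rewrite tnthS; exact: tB.
Qed.

Section random.
Context {d : measure_display} {T : measurableType d} {R : realType}.
Variable P : probability T R.

Definition uniformly_distributed (n : nat) (X : {RV P >-> n.-tuple R})
    (K : set (n.-tuple R)) : Prop :=
  forall A : set (n.-tuple R), measurable A ->
    distribution P X A = lebesgue_tuple (A `&` K) / lebesgue_tuple K.

Definition mutually_independent (I : finType) (Y : I -> {RV P >-> R}) : Prop :=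
  forall (J : {set I}) (B : I -> set R), (forall i, measurable (B i)) ->
    P (\bigcap_(i in [set` J]) (Y i @^-1` B i)) =
    \prod_(i in J) P (Y i @^-1` B i).

Definition identically_distributed (d' : measure_display)
    (T' : measurableType d') (P' : probability T' R)
    (Y : T -> R) (Y' : T' -> R) : Prop :=
  forall A : set R, measurable A -> pushforward P Y A = pushforward P' Y' A.

End random.

(* Main.v *)
(* Both laws are invariant under sign flips of the coordinates, so averaging the
   expanded p-th power over the flips leaves only monomials with even exponents
   k_i, with nonnegative coefficients, and it suffices to show
     E prod_i X_i^(k_i) <= prod_i E X_i^(k_i).
   Integrals over { sum_i f_i(|x_i|) <= s } are obtained by iterating the
   commuting operators
     (L_w Phi)(s) = int w(x) Phi(s - f(x)) dx
   on Phi = 1_[0,+oo[.  By the one-dimensional Prekopa-Leindler inequality, L_w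
   with w the indicator of an interval preserves log-concavity in s.  For such
   Phi, the proportion of the mass lying in {x^k > u} is nondecreasing in s;
   replacing the weights x_i^(k_i) by their layers {x_i^(k_i) > u} one coordinate
   at a time, the mean of prod_i x_i^(k_i) over the ball of level s is
   nondecreasing in s.  Conditioning on one coordinate x lowers the level to
   s - f(x), so Chebyshev's association inequality splits off that coordinate,
   and integrating it out leaves a log-concave Phi for the others. *)
Require Import Defs.
From HB Require Import structures.
From mathcomp Require Import all_boot all_order all_algebra.
From mathcomp Require Import all_classical all_reals all_analysis measurable_realfun.
From mathcomp Require Import ring lra.

Set Implicit Arguments.
Unset Strict Implicit.
Unset Printing Implicit Defensive.

Import Order.TTheory GRing.Theory Num.Theory.
Import numFieldNormedType.Exports.

Local Open Scope classical_set_scope.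
Local Open Scope ring_scope.
Local Open Scope ereal_scope.

(** The even power makes [(\sum_i a i * x_i) ^+ p] and every surviving monomial nonnegative, so all
    integrals can be taken in [\bar R], and Tonelli and the layer-cake formula apply without
    integrability conditions. Denominators are the obstacle: the mass of a slice can vanish, so
    every monotone ratio is stated cross-multiplied, [A s * C s' <= A s' * C s]. The base [Phi]
    stays an arbitrary log-concave function of the level, because both inductions on the dimension
    commute one slice operator past the others and absorb it into [Phi]. The absorbed weight is
    always an indicator: cutting [D] down to a layer gives another [profile] with the same [f], so
    log-concavity survives, and this is the reason for trading power weights for layers. A layer is
    an upper part of [D]; hence a point inside it and a point of [D] outside it are ordered, and
    each correlation inequality reduces to comparing [Phi] at the levels left by two such points. *)

Lemma nondecreasing_emeasurable (R : realType) (Phi : R -> \bar R) :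
  (forall s s' : R, (s <= s')%R -> Phi s <= Phi s') ->
  measurable_fun [set: R] Phi.
Proof.
move=> nd; apply: (measurability (@ErealGenInftyO.G R)).
  exact: ErealGenInftyO.measurableE.
move=> _ [_ [r ->] <-]; rewrite setTI; apply: is_interval_measurable.
move=> s t /=; rewrite !in_itv/= => sr tr u /andP[_ ut].
by rewrite in_itv/=; exact: le_lt_trans (nd _ _ ut) tr.
Qed.

Lemma measurable_bool_set (d : measure_display) (T : measurableType d)
    (b : T -> bool) : measurable_fun setT b -> measurable [set x | b x].
Proof.
move=> mb; rewrite (_ : mkset _ = setT `&` b @^-1` [set true]).
  exact: mb.
by rewrite setTI.
Qed.

Lemma indic_bool (R : pzRingType) (T : Type) (b : T -> bool) (x : T) :
  \1_[set y | b y] x = (b x)%:R :> R.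
Proof. by rewrite indicE mem_setE. Qed.

(** [w x] is the length of [[0, w x[]; Tonelli does the rest. The extra factor [Z] lets a single
    factor of a product be replaced by its layers. *)
Lemma layer_cake (R : realType) (d : measure_display) (T : measurableType d)
    (m : {sigma_finite_measure set T -> \bar R}) (w : T -> R) (Z : T -> \bar R) :
  measurable_fun [set: T] w -> measurable_fun [set: T] Z ->
  (forall x, 0 <= w x)%R -> (forall x, 0 <= Z x) ->
  \int[m]_x ((w x)%:E * Z x) =
  \int[lebesgue_measure]_(t in `[0%R, +oo[)
    \int[m]_x ((\1_[set y | (t < w y)%R] x)%:E * Z x).
Proof.
move=> mw mZ w0 Z0.
have wE x : (w x)%:E =
    \int[lebesgue_measure]_(t in `[0%R, +oo[) (\1_`]-oo, w x[ t)%:E.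
  rewrite integral_indic//= setIC -(set_itv_splitI `[0%R, w x[).
  rewrite lebesgue_measure_itv/= lte_fin.
  by case: ltgtP (w0 x) => [_|//|<-] _; rewrite ?sube0// oppe0 adde0.
pose F (p : T * measurableTypeR R) : \bar R :=
  (\1_[set q : T * measurableTypeR R | (0 <= q.2)%R && (q.2 < w q.1)%R] p)%:E * Z p.1.
have mF : measurable_fun setT F.
  apply: emeasurable_funM; last exact: measurableT_comp.
  apply/measurable_EFinP; apply: measurable_indic.
  apply: measurable_bool_set; apply: measurable_and.
    by apply: measurable_fun_ler => //; exact: measurable_snd.
  apply: measurable_fun_ltr; first exact: measurable_snd.
  exact: measurableT_comp.
have F0 p : 0 <= F p by rewrite mule_ge0// lee_fin.
transitivity (\int[m]_x \int[lebesgue_measure]_t F (x, t)).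
  apply: eq_integral => x _; rewrite wE [in LHS]integral_mkcond.
  rewrite -ge0_integralZr//; first last.
  - by move=> t _; apply: erestrict_ge0 => r _; rewrite lee_fin.
  - apply/(measurable_restrictT _ _).1 => //; apply: measurable_funTS.
    exact/measurable_EFinP/measurable_indic.
  apply: eq_integral => t _; rewrite /F patchE indic_bool indic_bool mem_setE/=.
  rewrite !in_itv/= andbT; case: (0 <= t)%R; first by rewrite andTb.
  by rewrite andFb; change (0 * Z x = 0%:E * Z x).
rewrite (fubini_tonelli F mF F0) [in RHS]integral_mkcond.
apply: eq_integral => t _; rewrite patchE mem_setE/= in_itv/= andbT.
case: ifPn => t0.
  by apply: eq_integral => x _; rewrite /F !indic_bool/= t0.
by apply: integral0_eq => x _; rewrite /F indic_bool/= (negbTE t0) mul0e.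
Qed.

(** * Commuting slice operators *)

Definition slice_op (R : realType) (w f : R -> R) (Phi : R -> \bar R) (s : R) :
    \bar R :=
  \int[lebesgue_measure]_x ((w x)%:E * Phi (s - f x)%R).

(** Monotonicity provides measurability for free. Vanishing at negative levels confines a slice at
    level [s] to [{f <= s}], which a [profile] bounds. *)
Record level_fun (R : realType) (Phi : R -> \bar R) : Prop := LevelFun {
  level_ge0 : forall s, 0 <= Phi s ;
  level_nd : forall s s' : R, (s <= s')%R -> Phi s <= Phi s' ;
  level_neg : forall s : R, (s < 0)%R -> Phi s = 0 }.

Lemma measurable_level_shift (R : realType) (Phi : R -> \bar R) (f : R -> R)
    (s : R) : level_fun Phi -> measurable_fun [set: R] f ->
  measurable_fun [set: R] (fun x => Phi (s - f x)%R).
Proof.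
move=> hPhi mf; apply: (measurableT_comp (f := Phi)).
  exact: nondecreasing_emeasurable (level_nd hPhi).
exact: measurable_funB.
Qed.

Lemma measurable_slice_integrand (R : realType) (Phi : R -> \bar R)
    (w f : R -> R) (s : R) : level_fun Phi -> measurable_fun [set: R] f ->
  measurable_fun [set: R] w ->
  measurable_fun [set: R] (fun x => (w x)%:E * Phi (s - f x)%R).
Proof.
move=> hPhi mf mw; apply: emeasurable_funM; first exact/measurable_EFinP.
exact: measurable_level_shift.
Qed.

(** Both sides integrate [w x * w' y * Phi (s - f x - f' y)], in the two orders. *)
Lemma slice_op_comm (R : realType) (Phi : R -> \bar R) (w f w' f' : R -> R) :
  level_fun Phi ->
  measurable_fun [set: R] w -> measurable_fun [set: R] f ->
  measurable_fun [set: R] w' -> measurable_fun [set: R] f' ->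
  (forall x, 0 <= w x)%R -> (forall x, 0 <= w' x)%R ->
  slice_op w f (slice_op w' f' Phi) = slice_op w' f' (slice_op w f Phi).
Proof.
move=> hPhi mw mf mw' mf' w0 w'0; apply/funext => s; rewrite /slice_op.
pose F (p : measurableTypeR R * measurableTypeR R) : \bar R :=
  (w p.1 * w' p.2)%:E * Phi (s - f p.1 - f' p.2)%R.
have mF : measurable_fun setT F.
  apply: emeasurable_funM.
    apply/measurable_EFinP; apply: measurable_funM.
      exact: (measurableT_comp (f := w)).
    exact: (measurableT_comp (f := w')).
  apply: (measurableT_comp (f := Phi)).
    exact: nondecreasing_emeasurable (level_nd hPhi).
  apply: measurable_funB; last exact: (measurableT_comp (f := f')).
  apply: measurable_funB => //; exact: (measurableT_comp (f := f)).
have F0 p : 0 <= F p by rewrite mule_ge0// ?lee_fin ?mulr_ge0// (level_ge0 hPhi).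
transitivity (\int[lebesgue_measure]_x \int[lebesgue_measure]_y F (x, y)).
  apply: eq_integral => x _; rewrite -ge0_integralZl//; first last.
  - by rewrite lee_fin.
  - by move=> y _; rewrite mule_ge0 ?lee_fin// (level_ge0 hPhi).
  - exact: measurable_slice_integrand.
  - by apply: eq_integral => y _; rewrite /F/= EFinM muleA.
rewrite (fubini_tonelli F)//=; apply: eq_integral => y _.
rewrite -ge0_integralZl//; first last.
- by rewrite lee_fin.
- by move=> x _; rewrite mule_ge0 ?lee_fin// (level_ge0 hPhi).
- exact: measurable_slice_integrand.
by apply: eq_integral => x _; rewrite /F/= mulrC EFinM muleA addrAC.
Qed.

(** A Young function on the half-line, as a real function [f] together with the set [D] where it
    counts. Keeping [D] separate allows infinite values to be cut off, and allows [D] to shrink to a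
    layer while [f] is unchanged. [D] may be empty, as happens for high layers. *)
Record profile (R : realType) (D : set R) (f : R -> R) : Prop := Profile {
  profile_meas : measurable D ;
  profile_mfun : measurable_fun [set: R] f ;
  profile_dom_ge0 : forall x, D x -> (0 <= x)%R ;
  profile_ge0 : forall x, (0 <= f x)%R ;
  profile_nd : forall x y, D x -> D y -> (x <= y)%R -> (f x <= f y)%R ;
  profile_dom_convex : forall x y t : R, D x -> D y -> (0 < t < 1)%R ->
    D (t * x + (1 - t) * y)%R ;
  profile_convex : forall x y t : R, D x -> D y -> (0 < t < 1)%R ->
    (f (t * x + (1 - t) * y) <= t * f x + (1 - t) * f y)%R ;
  profile_bounded : forall s, exists2 M : R, (0 <= M)%R &
    forall x, D x -> (f x <= s)%R -> (x <= M)%R }.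

Definition power_weight (R : realType) (D : set R) (k : nat) (x : R) : R :=
  (x ^+ k * \1_D x)%R.

Lemma power_weight_ge0 (R : realType) (D : set R) (k : nat) (x : R) :
  (forall x, D x -> (0 <= x)%R) -> (0 <= power_weight D k x)%R.
Proof.
move=> D0; rewrite /power_weight indicE; have [/set_mem /D0 x0|_] := boolP (x \in D).
  by rewrite mulr1 exprn_ge0.
by rewrite mulr0.
Qed.

Lemma measurable_power_weight (R : realType) (D : set R) (k : nat) :
  measurable D -> measurable_fun [set: R] (power_weight D k).
Proof.
by move=> mD; apply: measurable_funM; [exact: measurable_funX|exact: measurable_indic].
Qed.

Lemma power_weight0 (R : realType) (D : set R) :
  power_weight D 0 = \1_D :> (R -> R).
Proof. by apply/funext => x; rewrite /power_weight expr0 mul1r. Qed.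

Lemma slice_level (R : realType) (Phi : R -> \bar R) (w f : R -> R) :
  level_fun Phi -> measurable_fun [set: R] f -> measurable_fun [set: R] w ->
  (forall x, 0 <= w x)%R -> (forall x, 0 <= f x)%R ->
  level_fun (slice_op w f Phi).
Proof.
move=> hPhi mf mw w0 f0; split.
- move=> s; apply: integral_ge0 => x _.
  by rewrite mule_ge0 ?lee_fin// (level_ge0 hPhi).
- move=> s s' ss'; apply: ge0_le_integral => //.
  + by move=> x _; rewrite mule_ge0 ?lee_fin// (level_ge0 hPhi).
  + exact: measurable_slice_integrand.
  + exact: measurable_slice_integrand.
  + move=> x _; apply: lee_wpmul2l; rewrite ?lee_fin//.
    by apply: (level_nd hPhi); rewrite lerD2r.
- move=> s s0; apply: integral0_eq => x _.
  by rewrite (level_neg hPhi) ?mule0// ltrBlDr; apply: lt_le_trans s0 _;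
     rewrite add0r.
Qed.

(** On the nonnegative half-line [x ^+ k] is nondecreasing, and a convex combination is at least the
    smaller of its endpoints, so it stays in the layer. *)
Lemma setI_profile_power (R : realType) (D : set R) (f : R -> R) (k : nat)
    (u : R) : profile D f ->
  profile (D `&` [set x | (u < x ^+ k)%R]) f.
Proof.
move=> [mD mf D0 f0 nd Dc fc bd]; split => //.
- apply: measurableI => //; apply: measurable_bool_set.
  by apply: measurable_fun_ltr => //; exact: measurable_funX.
- by move=> x [/D0].
- by move=> x y [Dx _] [Dy _]; exact: nd.
- move=> x y t [Dx ux] [Dy uy] t01; split; first exact: Dc.
  wlog xy : x y t Dx ux Dy uy t01 / (x <= y)%R => [W|].
    have [|/ltW yx] := leP x y; first exact: W.
    rewrite addrC -{2}(_ : 1 - (1 - t) = t)%R; last by lra.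
    by apply: W => //; lra.
  apply: (lt_le_trans ux); rewrite lerXn2r ?nnegrE ?D0//.
    exact: Dc.
  by have : (0 <= (1 - t) * (y - x))%R by [apply: mulr_ge0; lra]; lra.
- by move=> x y t [Dx _] [Dy _]; exact: fc.
- by move=> s; have [M M0 hM] := bd s; exists M => // x [Dx _]; exact: hM.
Qed.

(** Only levels [u >= 0] occur; at such levels the points outside [D], whose weight is 0, belong to
    no layer, so the layers of the weight are those of [x ^+ k] inside [D]. *)
Lemma slice_power_layers (R : realType) (D : set R) (f : R -> R) (k : nat)
    (Phi : R -> \bar R) (s : R) : profile D f -> level_fun Phi ->
  slice_op (power_weight D k) f Phi s =
  \int[lebesgue_measure]_(u in `[0%R, +oo[)
    slice_op (\1_(D `&` [set x | (u < x ^+ k)%R])) f Phi s.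
Proof.
move=> hD hPhi; have mw := measurable_power_weight k (profile_meas hD).
have w0 x : (0 <= power_weight D k x)%R.
  exact: power_weight_ge0 (profile_dom_ge0 hD).
have mZ := measurable_level_shift s hPhi (profile_mfun hD).
rewrite /slice_op (layer_cake lebesgue_measure mw mZ w0); last first.
  by move=> x; exact: level_ge0.
apply: eq_integral => u /set_mem/=; rewrite in_itv/= andbT => u0.
apply: eq_integral => x _; congr (_%:E * _); congr (\1_ _ x).
apply/seteqP; split => y /=; rewrite /power_weight indicE.
  have [/set_mem Dy|_] := boolP (y \in D); first by rewrite mulr1.
  by rewrite mulr0 ltNge u0.
by move=> [Dy uy]; rewrite mem_set// mulr1.
Qed.

(** * Log-concavity of the slice operators *)

Lemma geometric_arithmetic_mean (R : realType) (a b t : R) :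
  (0 < a -> 0 < b -> 0 < t < 1 -> a `^ t * b `^ (1 - t) <= t * a + (1 - t) * b)%R.
Proof.
move=> a0 b0 /andP[t0 t1].
have := @concave_ln R (Itv01 (ltW t0) (ltW t1)) a b a0 b0.
rewrite /conv/= => h.
have ab0 : (0 < t * a + (1 - t) * b)%R by rewrite addr_gt0// mulr_gt0// subr_gt0.
rewrite -ler_ln ?posrE ?mulr_gt0 ?powR_gt0//.
rewrite lnM ?posrE ?powR_gt0// !ln_powR.
exact: h.
Qed.

(** A bounded convex set of reals has measure at most [sup - inf]. Points of [A] and [B] close to
    their endpoints combine into the endpoints of an open interval lying in [C], of nearly the
    required length. *)
Lemma convex_brunn_minkowski (R : realType) (A B C : set R) (t : R) :
  measurable A -> measurable B -> measurable C ->
  A !=set0 -> B !=set0 -> has_ubound A -> has_lbound A ->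
  has_ubound B -> has_lbound B -> (0 < t < 1)%R ->
  (forall x y u, A x -> A y -> (0 < u < 1)%R -> A (u * x + (1 - u) * y)%R) ->
  (forall x y u, B x -> B y -> (0 < u < 1)%R -> B (u * x + (1 - u) * y)%R) ->
  (forall x y, A x -> B y -> C (t * x + (1 - t) * y)%R) ->
  t%:E * lebesgue_measure A + (1 - t)%:E * lebesgue_measure B <=
  lebesgue_measure C.
Proof.
move=> mA mB mC A0 B0 uA lA uB lB t01 cA cB ABC.
have hull (S : set R) : measurable S -> S !=set0 -> has_ubound S -> has_lbound S ->
    lebesgue_measure S <= (sup S - inf S)%:E.
  move=> mS [s Ss] uS lS.
  have SI : (S `<=` `[inf S, sup S])%classic.
    by move=> x Sx /=; rewrite in_itv/= ge_inf//= ub_le_sup.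
  have infsup : (inf S <= sup S)%R.
    apply: (@le_trans _ _ s); first exact: ge_inf.
    exact: ub_le_sup.
  apply: (@le_trans _ _ (lebesgue_measure `[inf S, sup S]%classic)).
    by apply: le_measure; rewrite ?inE.
  rewrite lebesgue_measure_itv/= lte_fin; case: ltgtP infsup => // -> _.
  by rewrite subrr.
apply: (@le_trans _ _ (t * (sup A - inf A) + (1 - t) * (sup B - inf B))%:E).
  rewrite [leRHS]EFinD !EFinM; apply: leeD; apply: lee_wpmul2l.
  - by rewrite lee_fin; lra.
  - exact: hull.
  - by rewrite lee_fin; lra.
  - exact: hull.
apply/lee_addgt0Pr => e e0; rewrite -leeBlDr// -EFinB.
(* An error [e / 2] at each of two endpoints costs [e] per set; the weights [t] and [1 - t] keep the
   total at [e]. *)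
have e2 : (0 < e / 2)%R by lra.
have [a1 Aa1 ha1] := inf_adherent e2 (conj A0 lA).
have [a2 Aa2 ha2] := sup_adherent e2 (conj A0 uA).
have [b1 Bb1 hb1] := inf_adherent e2 (conj B0 lB).
have [b2 Bb2 hb2] := sup_adherent e2 (conj B0 uB).
pose z1 := (t * a1 + (1 - t) * b1)%R; pose z2 := (t * a2 + (1 - t) * b2)%R.
have zz : (t * (sup A - inf A) + (1 - t) * (sup B - inf B) - e <= z2 - z1)%R.
  have : (0 <= t * (e - (sup A - inf A) + (a2 - a1)))%R by apply: mulr_ge0; lra.
  have : (0 <= (1 - t) * (e - (sup B - inf B) + (b2 - b1)))%R by apply: mulr_ge0; lra.
  by rewrite /z1 /z2; lra.
apply: (@le_trans _ _ (z2 - z1)%:E); first by rewrite lee_fin.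
have [z12|z21] := ltP z1 z2; last first.
  by apply: (@le_trans _ _ 0); rewrite ?lee_fin ?subr_le0.
have -> : (z2 - z1)%:E = lebesgue_measure (`]z1, z2[%classic : set R).
  by rewrite lebesgue_measure_itv/= lte_fin z12 EFinB.
apply: le_measure; rewrite ?inE//.
move=> z /=; rewrite in_itv/= => /andP[z1z zz2].
(* The barycentric coordinate of [z] in [[z1, z2]], reused between [a1], [a2] and between [b1],
   [b2], exhibits [z] as a [t]-combination of a point of [A] and a point of [B]. *)
pose u := ((z2 - z) / (z2 - z1))%R.
have u01 : (0 < u < 1)%R.
  by rewrite /u divr_gt0 ?ltr_pdivrMr ?subr_gt0 ?mul1r//=; lra.
have -> : z = (t * (u * a1 + (1 - u) * a2) + (1 - t) * (u * b1 + (1 - u) * b2))%R.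
  transitivity (u * z1 + (1 - u) * z2)%R; last by rewrite /z1 /z2; ring.
  by rewrite /u; field; rewrite subr_eq0 gt_eqF.
by apply: ABC; [exact: cA|exact: cB].
Qed.

Lemma integral_superlevel (R : realType) (d : measure_display)
    (T : measurableType d) (m : {sigma_finite_measure set T -> \bar R})
    (w : T -> R) :
  measurable_fun [set: T] w -> (forall x, 0 <= w x)%R ->
  \int[m]_x (w x)%:E =
  \int[lebesgue_measure]_(u in `[0%R, +oo[) m [set x | (u < w x)%R].
Proof.
move=> mw w0.
have h := layer_cake m mw (measurable_cst 1) w0 (fun=> lee01).
transitivity (\int[m]_x ((w x)%:E * cst 1 x)).
  by apply: eq_integral => x _; rewrite mule1.
rewrite h; apply: eq_integral => u _.
under eq_integral do rewrite mule1.
rewrite integral_indic ?setIT//; apply: measurable_bool_set.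
exact: measurable_fun_ltr.
Qed.

Lemma measurable_superlevel (R : realType) (d : measure_display)
    (T : measurableType d) (m : {measure set T -> \bar R}) (w : T -> R) :
  measurable_fun [set: T] w ->
  measurable_fun [set: R] (fun u : R => m [set x | (u < w x)%R]).
Proof.
move=> mw; have mset u : measurable [set x | (u < w x)%R].
  by apply: measurable_bool_set; exact: measurable_fun_ltr.
(* Superlevel sets shrink as the level grows; the sign change gives a nondecreasing function. *)
pose g (u : R) := m [set x | (- u < w x)%R].
have mg : measurable_fun [set: R] g.
  apply: nondecreasing_emeasurable => s s' ss'; apply: le_measure; rewrite ?inE.
  - exact: mset.
  - exact: mset.
  - by move=> x /=; apply: le_lt_trans; rewrite lerN2.
rewrite (_ : (fun _ => _) = g \o -%R); first exact: measurableT_comp.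
by apply/funext => u; rewrite /g/= opprK.
Qed.

Record log_concave_level (R : realType) (Phi : R -> \bar R) : Prop :=
  LogConcaveLevel {
  lc_level : level_fun Phi ;
  lc_fin : forall s, Phi s \is a fin_num ;
  lc_power : forall s s' t : R, (0 < t < 1)%R ->
    (fine (Phi s) `^ t * fine (Phi s') `^ (1 - t) <=
     fine (Phi (t * s + (1 - t) * s')))%R }.

(** Both [p'] and [q'] lie between [p] and [q], with [p' = t p + (1 - t) q] and
    [q' = (1 - t) p + t q]. In the product of the two log-concavity inequalities each of [Phi p] and
    [Phi q] gets total exponent 1. *)
Lemma log_concave_exchange (R : realType) (Phi : R -> \bar R) (p q p' q' : R) :
  log_concave_level Phi ->
  (p <= p')%R -> (p <= q')%R -> (p + q = p' + q')%R ->
  Phi p * Phi q <= Phi p' * Phi q'.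
Proof.
move=> hPhi pp' pq' pq; have hl := lc_level hPhi.
have F r : (0 <= fine (Phi r))%R by apply: fine_ge0; exact: level_ge0.
move: pp'; rewrite le_eqVlt => /orP[/eqP ep|pp'].
  by rewrite ep (_ : q = q')//; lra.
move: pq'; rewrite le_eqVlt => /orP[/eqP ep|pq'].
  by rewrite muleC ep (_ : q = p')//; lra.
pose t := ((q - p') / (q - p))%R.
have t01 : (0 < t < 1)%R.
  by rewrite /t divr_gt0 ?ltr_pdivrMr ?subr_gt0 ?mul1r//=; lra.
have h1 := lc_power hPhi p q t01.
have t01' : (0 < 1 - t < 1)%R by lra.
have h2 := lc_power hPhi p q t01'.
have qp : (q - p != 0)%R by rewrite subr_eq0 gt_eqF//; lra.
have e1 : (t * p + (1 - t) * q = p')%R by rewrite /t; field.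
have e2 : ((1 - t) * p + (1 - (1 - t)) * q = q')%R.
  by rewrite (_ : q' = p + q - p')%R; [rewrite /t; field|lra].
rewrite e1 in h1; rewrite e2 in h2.
rewrite -(fineK (lc_fin hPhi p)) -(fineK (lc_fin hPhi q)).
rewrite -(fineK (lc_fin hPhi p')) -(fineK (lc_fin hPhi q')) -!EFinM lee_fin.
apply: le_trans (ler_pM _ _ h1 h2); rewrite ?mulr_ge0 ?powR_ge0//.
rewrite (_ : 1 - (1 - t) = t)%R; last by lra.
have powE (x : R) : (0 <= x)%R -> (x `^ t * x `^ (1 - t) = x)%R.
  rewrite le_eqVlt => /orP[/eqP <-|x0].
    by rewrite powR0 ?mul0r//; apply: lt0r_neq0; case/andP: t01.
  rewrite -powRD; last by apply/implyP => _; rewrite gt_eqF.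
  by rewrite addrC subrK powRr1// ltW.
rewrite -{1}(powE _ (F p)) -{1}(powE _ (F q)) le_eqVlt; apply/orP; left.
by apply/eqP; ring.
Qed.

(** On [D] and [{f <= s}] the points are at most some [M], so [x ^+ k <= M ^+ k]. The constant
    serves all levels [r <= s], because slicing only lowers the level. *)
Lemma slice_power_le (R : realType) (D : set R) (f : R -> R) (k : nat)
    (Phi Psi : R -> \bar R) (c s : R) :
  profile D f -> level_fun Phi -> level_fun Psi -> (0 <= c)%R ->
  (forall r, (r <= s)%R -> Psi r <= c%:E * Phi r) ->
  exists2 c', (0 <= c')%R & forall r, (r <= s)%R ->
    slice_op (power_weight D k) f Psi r <= c'%:E * slice_op (\1_D) f Phi r.
Proof.
move=> hD hPhi hPsi c0 hc; have [M M0 hM] := profile_bounded hD s.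
have mf := profile_mfun hD; have mD := profile_meas hD.
have cM : (0 <= M ^+ k * c)%R by rewrite mulr_ge0// exprn_ge0.
exists (M ^+ k * c)%R => // r rs; rewrite /slice_op -ge0_integralZl//; first last.
- by move=> x _; rewrite mule_ge0// ?lee_fin// level_ge0.
- by apply: measurable_slice_integrand => //; exact: measurable_indic.
apply: ge0_le_integral => //.
- move=> x _; apply: mule_ge0; last exact: level_ge0.
  by rewrite lee_fin; apply: power_weight_ge0; exact: profile_dom_ge0 hD.
- by apply: measurable_slice_integrand => //; exact: measurable_power_weight.
- apply: measurable_funeM.
  by apply: measurable_slice_integrand => //; exact: measurable_indic.
move=> x _; rewrite /power_weight indicE.
have [/set_mem Dx|_] := boolP (x \in D); last by rewrite mulr0 !mul0e mule0.
rewrite mulr1 mul1e; have [rfx|rfx] := ltP (r - f x)%R 0%R.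
  by rewrite (level_neg hPsi)// (level_neg hPhi)// !mule0.
have xM : (x <= M)%R by apply: hM => //; rewrite subr_ge0 in rfx; exact: le_trans rs.
have x0 := profile_dom_ge0 hD Dx.
apply: (@le_trans _ _ ((x ^+ k)%:E * (c%:E * Phi (r - f x)%R))).
  apply: lee_wpmul2l; first by rewrite lee_fin exprn_ge0.
  by apply: hc; have := profile_ge0 hD x; lra.
rewrite muleA -EFinM; apply: lee_wpmul2r; first exact: level_ge0.
by rewrite lee_fin ler_wpM2r// lerXn2r.
Qed.

(** The integrand is at most [Phi s] and is supported in a bounded interval [[0, M]]. *)
Lemma slice_fin_num (R : realType) (D : set R) (f : R -> R) (Phi : R -> \bar R)
    (s : R) : profile D f -> log_concave_level Phi ->
  slice_op (\1_D) f Phi s \is a fin_num.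
Proof.
move=> hD hPhi; have hl := lc_level hPhi.
have mf := profile_mfun hD; have mD := profile_meas hD.
have [M M0 hM] := profile_bounded hD s.
rewrite ge0_fin_numE; last first.
  by apply: integral_ge0 => x _; rewrite mule_ge0 ?lee_fin// level_ge0.
apply: (@le_lt_trans _ _ (\int[lebesgue_measure]_x
    (Phi s * (\1_(`[0%R, M]%classic : set R) x)%:E))).
  apply: ge0_le_integral => //.
  - by move=> x _; rewrite mule_ge0 ?lee_fin// level_ge0.
  - by apply: measurable_slice_integrand => //; exact: measurable_indic.
  - by apply: measurable_funeM; exact/measurable_EFinP/measurable_indic.
  move=> x _; rewrite !indicE.
  have [/set_mem Dx|_] := boolP (x \in D); last first.
    by rewrite mul0e mule_ge0 ?lee_fin// level_ge0.
  rewrite mul1e; have [sfx|sfx] := ltP (s - f x)%R 0%R.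
    by rewrite (level_neg hl)// mule_ge0 ?lee_fin// level_ge0.
  rewrite mem_set/= ?in_itv/= ?(profile_dom_ge0 hD Dx)/=; last first.
    by apply: hM => //; rewrite subr_ge0 in sfx.
  by rewrite mule1; apply: level_nd => //; have := profile_ge0 hD x; lra.
rewrite ge0_integralZl//; first last.
- exact: level_ge0.
- exact/measurable_EFinP/measurable_indic.
rewrite integral_indic// setIT; rewrite -ge0_fin_numE; last first.
  by rewrite mule_ge0// level_ge0.
rewrite fin_numM ?lc_fin//= lebesgue_measure_itv/=; by case: ifP.
Qed.

Section slice_log_concave.
Variables (R : realType) (D : set R) (f : R -> R) (Phi : R -> \bar R).
Hypotheses (hD : profile D f) (hPhi : log_concave_level Phi).

Let h (s x : R) : R := fine (Phi (s - f x)).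
Let V (s : R) : R := fine (slice_op (\1_D) f Phi s).
Let top (s : R) : R := sup [set h s x | x in D].
Let w (s c x : R) : R := (h s x / c * \1_D x)%R.

Let hE s x : (h s x)%:E = Phi (s - f x)%R.
Proof. by rewrite /h fineK//; exact: lc_fin. Qed.

Let h_ge0 s x : (0 <= h s x)%R.
Proof. by rewrite -lee_fin hE; exact: level_ge0 (lc_level hPhi) _. Qed.

Let h_neg s x : (0 < h s x)%R -> (f x <= s)%R.
Proof.
rewrite -lte_fin hE leNgt => h0; apply/negP => sfx; move: h0.
by rewrite (level_neg (lc_level hPhi)) ?ltxx// subr_lt0.
Qed.

Let h_le s x : (h s x <= fine (Phi s))%R.
Proof.
apply: fine_le; [exact: lc_fin|exact: lc_fin|].
by apply: level_nd (lc_level hPhi) _ _ _; have := profile_ge0 hD x; lra.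
Qed.

(** Convexity bounds [f] at the combination by the larger of [f x] and [f y], and [Phi] is
    nondecreasing. This quasi-concavity turns superlevel sets within [D] into intervals. *)
Let h_convex s x y (u : R) : D x -> D y -> (0 < u < 1)%R ->
  (Num.min (h s x) (h s y) <= h s (u * x + (1 - u) * y))%R.
Proof.
move=> Dx Dy u01; have := profile_convex hD Dx Dy u01.
set z := (u * x + _)%R => fz; rewrite ge_min -!lee_fin !hE; apply/orP.
have [fxy|/ltW fxy] := leP (f x) (f y); [right|left];
  apply: level_nd (lc_level hPhi) _ _ _; rewrite lerD2l lerN2.
- have : (0 <= u * (f y - f x))%R by apply: mulr_ge0; lra.
  by lra.
- have : (0 <= (1 - u) * (f x - f y))%R by apply: mulr_ge0; lra.
  by lra.
Qed.

Let mh s : measurable_fun [set: R] (h s).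
Proof.
apply/measurable_EFinP; rewrite (_ : _ \o _ = fun x => Phi (s - f x)%R).
  exact: measurable_level_shift (lc_level hPhi) (profile_mfun hD).
by apply/funext => x /=; rewrite hE.
Qed.

Let mw s c : measurable_fun [set: R] (w s c).
Proof.
apply: measurable_funM.
  by apply: measurable_funM; [exact: mh|exact: measurable_cst].
apply: measurable_indic; exact: profile_meas hD.
Qed.

Let w_ge0 s (c : R) x : (0 < c)%R -> (0 <= w s c x)%R.
Proof. by move=> c0; rewrite /w mulr_ge0// divr_ge0// ltW. Qed.

Let superlevelE s (c u : R) : (0 < c)%R -> (0 <= u)%R ->
  [set x | (u < w s c x)%R] = D `&` [set x | (u * c < h s x)%R].
Proof.
move=> c0 u0; apply/seteqP; split => x /=; rewrite /w indicE.
  have [/set_mem Dx|_] := boolP (x \in D); last by rewrite mulr0 ltNge u0.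
  by rewrite mulr1 ltr_pdivlMr.
by move=> [Dx uc]; rewrite mem_set// mulr1 ltr_pdivlMr.
Qed.

Let integral_w s (c : R) : (0 < c)%R ->
  \int[lebesgue_measure]_x (w s c x)%:E = (V s / c)%:E.
Proof.
move=> c0; rewrite /V mulrC EFinM fineK; last exact: slice_fin_num.
rewrite /slice_op -ge0_integralZl//; first last.
- by rewrite lee_fin invr_ge0 ltW.
- move=> x _; apply: mule_ge0; first by rewrite lee_fin.
  exact: level_ge0 (lc_level hPhi) _.
- apply: measurable_slice_integrand; first exact: lc_level.
    exact: profile_mfun hD.
  apply: measurable_indic; exact: profile_meas hD.
apply: eq_integral => x _; rewrite -hE -!EFinM /w; congr (_%:E).
by ring.
Qed.

Let sup_h s : (0 < V s)%R -> has_sup [set h s x | x in D].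
Proof.
move=> V0; split; last first.
  by exists (fine (Phi s)) => _ [x _ <-]; exact: h_le.
apply/set0P/negP => /eqP/image_set0_set0 D0; move: V0.
rewrite /V /slice_op D0 integral0_eq ?ltxx// => x _.
by rewrite indicE in_set0 mul0e.
Qed.

Let top_gt0 s : (0 < V s)%R -> (0 < top s)%R.
Proof.
move=> V0; rewrite ltNge; apply/negP => top0; move: (V0).
rewrite /V /slice_op integral0_eq ?ltxx// => x _; rewrite indicE.
have [/set_mem Dx|_] := boolP (x \in D); last by rewrite mul0e.
rewrite -hE (_ : h s x = 0%R) ?mule0//; apply/eqP; rewrite eq_le h_ge0 andbT.
apply: le_trans top0; apply: ub_le_sup; first by have [] := sup_h V0.
by exists x.
Qed.

Let superlevel_convex s u (A := D `&` [set x | (u < h s x)%R]) (x y t : R) :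
  A x -> A y -> (0 < t < 1)%R -> A (t * x + (1 - t) * y)%R.
Proof.
move=> [Dx hx] [Dy hy] t01; split; first exact: profile_dom_convex hD _ _ _ Dx Dy t01.
by apply: lt_le_trans (h_convex s Dx Dy t01); rewrite lt_min hx.
Qed.

Let superlevel_bounded s u (A := D `&` [set x | (u < h s x)%R]) : (0 <= u)%R ->
  has_ubound A /\ has_lbound A.
Proof.
move=> u0; have [M M0 hM] := profile_bounded hD s; split.
  exists M => x [Dx ux]; apply: hM => //; apply: h_neg.
  exact: le_lt_trans u0 ux.
by exists 0%R => x [Dx _]; exact: profile_dom_ge0 hD _ Dx.
Qed.

Let superlevel_nonempty s u : (0 < V s)%R -> (u < 1)%R ->
  D `&` [set x | (u * top s < h s x)%R] !=set0.
Proof.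
move=> V0 u1; have t0 := top_gt0 V0.
have e0 : (0 < (1 - u) * top s)%R by apply: mulr_gt0 => //; lra.
have [_ [x Dx <-] hx] := sup_adherent e0 (sup_h V0).
by exists x; split => //=; apply: le_lt_trans hx; rewrite /top; lra.
Qed.

(** The proof of Prekopa-Leindler by levels: [convex_brunn_minkowski] at each level [u < 1] gives an
    arithmetic-mean inequality between the normalized integrals, and the mean inequality
    [geometric_arithmetic_mean] turns it into the geometric one. *)
Lemma slice_log_concave : log_concave_level (slice_op (\1_D) f Phi).
Proof.
have mD := profile_meas hD; have mf := profile_mfun hD.
split.
- apply: slice_level => //; first exact: lc_level.
  exact: profile_ge0 hD.
- by move=> s; exact: slice_fin_num.
move=> s s' t t01; rewrite -!/(V _).
have V_ge0 r : (0 <= V r)%R.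
  apply: fine_ge0; apply: integral_ge0 => x _; apply: mule_ge0.
    by rewrite lee_fin.
  exact: level_ge0 (lc_level hPhi) _.
(* Rescaling each integrand by its supremum makes the superlevel sets of both
   nonempty for exactly the same levels u < 1. *)
have [V0|V0] := leP (V s) 0%R.
  rewrite (_ : V s = 0%R); last by apply/eqP; rewrite eq_le V0 V_ge0.
  by rewrite powR0 ?mul0r//; apply: lt0r_neq0; case/andP: t01.
have [V1|V1] := leP (V s') 0%R.
  rewrite (_ : V s' = 0%R); last by apply/eqP; rewrite eq_le V1 V_ge0.
  by rewrite [X in (_ * X)%R]powR0 ?mulr0//; apply: lt0r_neq0; lra.
have c0 := top_gt0 V0; have c1 := top_gt0 V1.
set r := (t * s + (1 - t) * s')%R.
(* The geometric mean of the two suprema is the normalization for level [r]: by log-concavity,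
   values above [u * top s] and [u * top s'] combine to a value above [u * c]. *)
pose c := (top s `^ t * top s' `^ (1 - t))%R.
have cp : (0 < c)%R by rewrite /c mulr_gt0// powR_gt0.
suff H : (t * (V s / top s) + (1 - t) * (V s' / top s') <= V r / c)%R.
  have := geometric_arithmetic_mean (divr_gt0 V0 c0) (divr_gt0 V1 c1) t01.
  move=> /le_trans /(_ H); rewrite ler_pdivlMr//; apply: le_trans.
  rewrite /c mulrACA.
  rewrite -!powRM ?divr_ge0 ?(ltW V0, ltW V1, ltW c0, ltW c1)//.
  by rewrite !divfK ?lt0r_neq0.
rewrite -lee_fin EFinD !EFinM -!(EFinM (V _)) -!integral_w//.
rewrite !integral_superlevel; [|by [exact: mw|move=> x; exact: w_ge0]..].
have itvm : measurable (`[0%R, +oo[%classic : set R) by exact: measurable_itv.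
have ms v a : measurable_fun (`[0%R, +oo[%classic : set R)
    (fun u : R => lebesgue_measure [set x : R | (u < w v a x)%R]).
  by apply: measurable_funTS; apply: measurable_superlevel; exact: mw.
have t0 : 0 <= t%:E by rewrite lee_fin; lra.
have t1 : 0 <= (1 - t)%:E by rewrite lee_fin; lra.
rewrite -!ge0_integralZl//; [|exact: ms..].
rewrite -ge0_integralD//; first last.
- by apply: measurable_funeM; exact: ms.
- by move=> u _; rewrite mule_ge0.
- by apply: measurable_funeM; exact: ms.
- by move=> u _; rewrite mule_ge0.
apply: ge0_le_integral => //.
- by move=> u _; rewrite adde_ge0// mule_ge0.
- by apply: emeasurable_funD; apply: measurable_funeM; exact: ms.
- exact: ms.
move=> u; rewrite /= in_itv/= andbT => u0.
(* For [u >= 1] neither normalized integrand exceeds [u], so the left side is 0. *)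
rewrite !superlevelE//; have [u1|u1] := ltP u 1%R; last first.
  have E v : (0 < V v)%R -> D `&` [set x | (u * top v < h v x)%R] = set0.
    move=> Vv; apply/seteqP; split => // x [Dx /=]; apply/negP; rewrite -leNgt.
    have : (h v x <= top v)%R.
      by apply: ub_le_sup; [have [] := sup_h Vv|exists x].
    by move/le_trans; apply; rewrite ler_peMl// ltW// top_gt0.
  by rewrite !E// !measure0 !mule0 adde0.
have lev v a : measurable (D `&` [set x | (a < h v x)%R]).
  apply: measurableI => //; apply: measurable_bool_set.
  by apply: measurable_fun_ltr => //; exact: mh.
have [ub0 lb0] := @superlevel_bounded s (u * top s)%R (mulr_ge0 u0 (ltW c0)).
have [ub1 lb1] := @superlevel_bounded s' (u * top s')%R (mulr_ge0 u0 (ltW c1)).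
apply: convex_brunn_minkowski => //.
- exact: superlevel_nonempty.
- exact: superlevel_nonempty.
- exact: superlevel_convex.
- exact: superlevel_convex.
move=> x y [Dx /= hx] [Dy /= hy]; split => /=.
  exact: profile_dom_convex hD _ _ _ Dx Dy t01.
(* Log-concavity is applied at the levels [s - f x] and [s' - f y]. By convexity of [f] their
   combination is at most [r] minus [f] at the combined point, and [Phi] is nondecreasing. *)
apply: (@lt_le_trans _ _ (h s x `^ t * h s' y `^ (1 - t))%R); last first.
  apply: le_trans (lc_power hPhi _ _ t01) _.
  apply: fine_le; [exact: lc_fin|exact: lc_fin|].
  apply: level_nd (lc_level hPhi) _ _ _.
  by have := profile_convex hD Dx Dy t01; rewrite /r; lra.
have -> : (u * c = (u * top s) `^ t * (u * top s') `^ (1 - t))%R.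
  rewrite !powRM ?(ltW c0, ltW c1)// mulrACA -powRD; last first.
    by rewrite addrC subrK oner_eq0.
  by rewrite addrC subrK powRr1.
apply: ltr_pM; rewrite ?powR_ge0//; apply: gt0_ltr_powR => //;
  rewrite ?nnegrE ?mulr_ge0// ?ltW//; by lra.
Qed.

End slice_log_concave.

(** * Correlation inequalities for iterated slices *)

(** Each product is a double integral over [A] times [B], and the integrands compare pointwise. *)
Lemma integral_cross (R : realType) (A B : set R) (u v : R -> \bar R) :
  measurable A -> measurable B ->
  measurable_fun [set: R] u -> measurable_fun [set: R] v ->
  (forall x, 0 <= u x) -> (forall x, 0 <= v x) ->
  (forall x y, A x -> B y -> u x * v y <= v x * u y) ->
  (\int[lebesgue_measure]_x ((\1_A x)%:E * u x)) *
    (\int[lebesgue_measure]_x ((\1_B x)%:E * v x)) <=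
  (\int[lebesgue_measure]_x ((\1_A x)%:E * v x)) *
    (\int[lebesgue_measure]_x ((\1_B x)%:E * u x)).
Proof.
move=> mA mB mu mv u0 v0 uv.
have mI (S : set R) (g : R -> \bar R) : measurable S ->
    measurable_fun [set: R] g ->
    measurable_fun [set: R] (fun x => (\1_S x)%:E * g x).
  move=> mS mg; apply: emeasurable_funM => //.
  by apply/measurable_EFinP; exact: measurable_indic.
have I0 (S : set R) (g : R -> \bar R) x : (forall x, 0 <= g x) ->
    0 <= (\1_S x)%:E * g x.
  by move=> g0; apply: mule_ge0 => //; rewrite lee_fin.
have J0 (S : set R) (g : R -> \bar R) : (forall x, 0 <= g x) ->
    0 <= \int[lebesgue_measure]_x ((\1_S x)%:E * g x).
  by move=> g0; apply: integral_ge0 => x _; exact: I0.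
rewrite -ge0_integralZr//; [|exact: mI|by move=> x _; exact: I0|exact: J0].
rewrite -ge0_integralZr//; [|exact: mI|by move=> x _; exact: I0|exact: J0].
apply: ge0_le_integral => //.
- by move=> x _; apply: mule_ge0; [exact: I0|exact: J0].
- by apply: emeasurable_funM; [exact: mI|exact: measurable_cst].
- by apply: emeasurable_funM; [exact: mI|exact: measurable_cst].
move=> x _; rewrite [X in _ <= X](_ : _ = (\1_A x)%:E *
  (v x * \int[lebesgue_measure]_y ((\1_B y)%:E * u y))); last by rewrite muleA.
rewrite -muleA.
have [xA|xA] := boolP (x \in A); last by rewrite indicE (negbTE xA) !mul0e.
apply: lee_wpmul2l; first by rewrite lee_fin.
rewrite -ge0_integralZl//; [|exact: mI|by move=> y _; exact: I0].
rewrite -ge0_integralZl//; [|exact: mI|by move=> y _; exact: I0].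
apply: ge0_le_integral => //.
- by move=> y _; apply: mule_ge0; [exact: u0|exact: I0].
- by apply: measurable_funeM; exact: mI.
- by apply: measurable_funeM; exact: mI.
move=> y _; rewrite muleCA [X in _ <= X]muleCA.
have [yB|yB] := boolP (y \in B); last by rewrite indicE (negbTE yB) !mul0e.
by apply: lee_wpmul2l; [rewrite lee_fin|exact: uv (set_mem xA) (set_mem yB)].
Qed.

(** Splitting [D] into [A] and its complement, the contributions of pairs in [A] times [A] agree on
    both sides by symmetry; only pairs with [y] outside [A] have to be compared. *)
Lemma integral_cross_sub (R : realType) (A D : set R) (u v : R -> \bar R) :
  measurable A -> measurable D -> A `<=` D ->
  measurable_fun [set: R] u -> measurable_fun [set: R] v ->
  (forall x, 0 <= u x) -> (forall x, 0 <= v x) ->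
  (forall x y, A x -> D y -> ~ A y -> u x * v y <= v x * u y) ->
  (\int[lebesgue_measure]_x ((\1_A x)%:E * u x)) *
    (\int[lebesgue_measure]_x ((\1_D x)%:E * v x)) <=
  (\int[lebesgue_measure]_x ((\1_A x)%:E * v x)) *
    (\int[lebesgue_measure]_x ((\1_D x)%:E * u x)).
Proof.
move=> mA mD AD mu mv u0 v0 uv.
have mDA : measurable (D `\` A) by exact: measurableD.
have mI (S : set R) (g : R -> \bar R) : measurable S ->
    measurable_fun [set: R] g ->
    measurable_fun [set: R] (fun x => (\1_S x)%:E * g x).
  move=> mS mg; apply: emeasurable_funM => //.
  by apply/measurable_EFinP; exact: measurable_indic.
have I0 (S : set R) (g : R -> \bar R) x : (forall x, 0 <= g x) ->
    0 <= (\1_S x)%:E * g x.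
  by move=> g0; apply: mule_ge0 => //; rewrite lee_fin.
have J0 (S : set R) (g : R -> \bar R) : (forall x, 0 <= g x) ->
    0 <= \int[lebesgue_measure]_x ((\1_S x)%:E * g x).
  by move=> g0; apply: integral_ge0 => x _; exact: I0.
have split_int (g : R -> \bar R) : measurable_fun [set: R] g ->
    (forall x, 0 <= g x) ->
    \int[lebesgue_measure]_x ((\1_D x)%:E * g x) =
    \int[lebesgue_measure]_x ((\1_A x)%:E * g x) +
    \int[lebesgue_measure]_x ((\1_(D `\` A) x)%:E * g x).
  move=> mg g0; rewrite -ge0_integralD//; first last.
  - exact: mI.
  - by move=> x _; exact: I0.
  - exact: mI.
  - by move=> x _; exact: I0.
  apply: eq_integral => x _; rewrite !indicE in_setD.
  have [/set_mem Ax|_] := boolP (x \in A).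
    by rewrite (mem_set (AD _ Ax)) mul0e adde0.
  by rewrite andbT mul0e add0e.
rewrite !split_int//.
have J0u := fun S => J0 S u u0; have J0v := fun S => J0 S v v0.
rewrite (ge0_muleDr _ (J0v A) (J0v (D `\` A))).
rewrite (ge0_muleDr _ (J0u A) (J0u (D `\` A))).
apply: leeD; first by rewrite muleC.
apply: integral_cross => // x y Ax [Dy nAy]; exact: uv.
Qed.

Lemma power_level_lt (R : realType) (D : set R) (f : R -> R) (k : nat)
    (u x y : R) : profile D f -> D x -> (u < x ^+ k)%R -> D y ->
  ~ (D `&` [set x | (u < x ^+ k)%R]) y -> (y <= x)%R.
Proof.
move=> hD Dx ux Dy nU; rewrite leNgt; apply/negP => xy; apply: nU.
split => //=; apply: lt_le_trans ux _; have x0 := profile_dom_ge0 hD Dx.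
by rewrite lerXn2r ?nnegrE ?(ltW xy)// (le_trans x0) ?ltW.
Qed.

(** For [x] in [U] and [y] in [D] outside [U], [y <= x] gives [f y <= f x]. Then [s - f x] is the
    least of the four levels, [s' - f y] the greatest, and [log_concave_exchange] moves the product
    inward to [s - f y] and [s' - f x]. *)
Lemma slice_prefix_ratio (R : realType) (D : set R) (f : R -> R) (k : nat)
    (u : R) (Phi : R -> \bar R) (s s' : R) :
  profile D f -> log_concave_level Phi -> (s <= s')%R ->
  let U := D `&` [set x | (u < x ^+ k)%R] in
  slice_op (\1_U) f Phi s * slice_op (\1_D) f Phi s' <=
  slice_op (\1_U) f Phi s' * slice_op (\1_D) f Phi s.
Proof.
move=> hD hPhi ss'; cbv zeta; set U := D `&` _; have hl := lc_level hPhi.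
have hU := setI_profile_power k u hD.
apply: integral_cross_sub.
- exact: profile_meas hU.
- exact: profile_meas hD.
- by move=> x [].
- apply: measurable_level_shift => //; exact: profile_mfun hD.
- apply: measurable_level_shift => //; exact: profile_mfun hD.
- by move=> x; exact: level_ge0.
- by move=> x; exact: level_ge0.
move=> x y [Dx ux] Dy nUy; have yx := power_level_lt hD Dx ux Dy nUy.
have fyx := profile_nd hD Dy Dx yx.
by rewrite [leRHS]muleC; apply: log_concave_exchange => //; lra.
Qed.

(** Points of [U] leave the lower level [s - f x], where the nondecreasing ratio of [Psi] to [Phi]
    is smaller: large values of the coordinate go with small values of the ratio. *)
Lemma slice_prefix_chebyshev (R : realType) (D : set R) (f : R -> R) (k : nat)
    (u : R) (Phi Psi : R -> \bar R) (s : R) :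
  profile D f -> level_fun Phi -> level_fun Psi ->
  (forall r r', (r <= r')%R -> Psi r * Phi r' <= Psi r' * Phi r) ->
  let U := D `&` [set x | (u < x ^+ k)%R] in
  slice_op (\1_U) f Psi s * slice_op (\1_D) f Phi s <=
  slice_op (\1_U) f Phi s * slice_op (\1_D) f Psi s.
Proof.
move=> hD hPhi hPsi ratio; cbv zeta; set U := D `&` _.
have hU := setI_profile_power k u hD.
apply: integral_cross_sub.
- exact: profile_meas hU.
- exact: profile_meas hD.
- by move=> x [].
- apply: measurable_level_shift => //; exact: profile_mfun hD.
- apply: measurable_level_shift => //; exact: profile_mfun hD.
- by move=> x; exact: level_ge0.
- by move=> x; exact: level_ge0.
move=> x y [Dx ux] Dy nUy; have yx := power_level_lt hD Dx ux Dy nUy.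
have fyx := profile_nd hD Dy Dx yx.
by rewrite [leRHS]muleC; apply: ratio; lra.
Qed.

(** Both sides are linear in the weight, so an inequality on every layer integrates to the power
    weight. Both the function and the level may change between the sides, since the ratio argument
    changes the level and the Chebyshev argument the function. *)
Lemma slice_layers_le (R : realType) (D : set R) (f : R -> R) (k : nat)
    (Phi Psi : R -> \bar R) (s s' : R) (a b : \bar R) :
  profile D f -> level_fun Phi -> level_fun Psi -> 0 <= a -> 0 <= b ->
  (forall u : R, let U := D `&` [set x | (u < x ^+ k)%R] in
    slice_op (\1_U) f Phi s * a <= slice_op (\1_U) f Psi s' * b) ->
  slice_op (power_weight D k) f Phi s * a <=
  slice_op (power_weight D k) f Psi s' * b.
Proof.
move=> hD hPhi hPsi a0 b0 le_ab.
have mU u : measurable (D `&` [set x | (u < x ^+ k)%R]).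
  exact: profile_meas (setI_profile_power k u hD).
have S0 (X : R -> \bar R) (r u : R) : level_fun X ->
    0 <= slice_op (\1_(D `&` [set x | (u < x ^+ k)%R])) f X r.
  move=> hX; apply: integral_ge0 => x _; apply: mule_ge0.
    by rewrite lee_fin.
  exact: level_ge0.
have mS (X : R -> \bar R) (r : R) : level_fun X -> measurable_fun [set: R]
    (fun u : R => slice_op (\1_(D `&` [set x | (u < x ^+ k)%R])) f X r).
  move=> hX; pose g (u : R) :=
    slice_op (\1_(D `&` [set x | (- u < x ^+ k)%R])) f X r.
  have mg : measurable_fun [set: R] g.
    apply: nondecreasing_emeasurable => v v' vv'; apply: ge0_le_integral => //.
    - move=> x _; apply: mule_ge0; first by rewrite lee_fin.
      exact: level_ge0.
    - by apply: measurable_slice_integrand => //; exact: profile_mfun hD.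
    - by apply: measurable_slice_integrand => //; exact: profile_mfun hD.
    move=> x _; apply: lee_wpmul2r; first exact: level_ge0.
    rewrite lee_fin !indicE ler_nat.
    have [/set_mem[Dx /= vx]|//] := boolP (x \in _).
    by rewrite mem_set//; split => //=; apply: le_lt_trans vx; rewrite lerN2.
  rewrite (_ : (fun _ => _) = g \o -%R); first exact: measurableT_comp.
  by apply/funext => u; rewrite /g/= opprK.
rewrite !slice_power_layers//.
have mitv : measurable (`[0%R, +oo[%classic : set R) by exact: measurable_itv.
rewrite -ge0_integralZr//; [|by apply: measurable_funTS; exact: mS|by move=> u _; exact: S0].
rewrite -ge0_integralZr//; [|by apply: measurable_funTS; exact: mS|by move=> u _; exact: S0].
apply: ge0_le_integral => //.
- by move=> u _; apply: mule_ge0 => //; exact: S0.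
- by apply: emeasurable_funM; [by apply: measurable_funTS; exact: mS|exact: measurable_cst].
- by apply: emeasurable_funM; [by apply: measurable_funTS; exact: mS|exact: measurable_cst].
Qed.

(** With [Phi = step_level] this is the integral of the monomial with exponents [k] over the
    nonnegative part of the ball of level [s]; exponents all 0 give its volume. *)
Fixpoint iter_slice (R : realType) (n : nat) :
    ('I_n -> set R) -> ('I_n -> R -> R) -> ('I_n -> nat) ->
    (R -> \bar R) -> R -> \bar R :=
  match n with
  | 0 => fun _ _ _ Phi => Phi
  | m.+1 => fun D f k Phi =>
      slice_op (power_weight (D ord0) (k ord0)) (f ord0)
        (iter_slice (fun i => D (lift ord0 i)) (fun i => f (lift ord0 i))
          (fun i => k (lift ord0 i)) Phi)
  end.

Section iter_slice_theory.
Variable R : realType.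

Lemma power_slice_level (D : set R) (f : R -> R) (k : nat) (Phi : R -> \bar R) :
  profile D f -> level_fun Phi ->
  level_fun (slice_op (power_weight D k) f Phi).
Proof.
move=> hD hPhi; apply: slice_level => //.
- exact: profile_mfun hD.
- by apply: measurable_power_weight; exact: profile_meas hD.
- by move=> x; apply: power_weight_ge0; exact: profile_dom_ge0 hD.
- exact: profile_ge0 hD.
Qed.

Lemma power_slice_comm (D D' : set R) (f f' : R -> R) (k k' : nat)
    (Phi : R -> \bar R) :
  profile D f -> profile D' f' -> level_fun Phi ->
  slice_op (power_weight D k) f (slice_op (power_weight D' k') f' Phi) =
  slice_op (power_weight D' k') f' (slice_op (power_weight D k) f Phi).
Proof.
move=> hD hD' hPhi; apply: slice_op_comm => //.
- by apply: measurable_power_weight; exact: profile_meas hD.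
- exact: profile_mfun hD.
- by apply: measurable_power_weight; exact: profile_meas hD'.
- exact: profile_mfun hD'.
- by move=> x; apply: power_weight_ge0; exact: profile_dom_ge0 hD.
- by move=> x; apply: power_weight_ge0; exact: profile_dom_ge0 hD'.
Qed.

Lemma iter_slice_level (n : nat) (D : 'I_n -> set R) (f : 'I_n -> R -> R)
    (k : 'I_n -> nat) (Phi : R -> \bar R) :
  (forall i, profile (D i) (f i)) -> level_fun Phi ->
  level_fun (iter_slice D f k Phi).
Proof.
elim: n => [|n IH] in D f k * => hD hPhi //=.
by apply: power_slice_level => //; apply: IH => // i; exact: hD.
Qed.

Lemma iter_slice_log_concave (n : nat) (D : 'I_n -> set R)
    (f : 'I_n -> R -> R) (Phi : R -> \bar R) :
  (forall i, profile (D i) (f i)) -> log_concave_level Phi ->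
  log_concave_level (iter_slice D f (fun=> 0%N) Phi).
Proof.
elim: n => [|n IH] in D f * => hD hPhi //=.
rewrite power_weight0; apply: slice_log_concave => //.
by apply: IH => // i; exact: hD.
Qed.

Lemma iter_slice_comm (n : nat) (D : 'I_n -> set R) (f : 'I_n -> R -> R)
    (k : 'I_n -> nat) (D' : set R) (f' : R -> R) (k' : nat)
    (Phi : R -> \bar R) :
  (forall i, profile (D i) (f i)) -> profile D' f' -> level_fun Phi ->
  slice_op (power_weight D' k') f' (iter_slice D f k Phi) =
  iter_slice D f k (slice_op (power_weight D' k') f' Phi).
Proof.
move=> hD hD' hPhi; elim: n => [|n IH] in D f k hD * => //=.
rewrite power_slice_comm//; last by apply: iter_slice_level => // i; exact: hD.
by rewrite IH.
Qed.

(** Domination by the volume has two uses: a weighted slice vanishes when the unweighted one does,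
    and it is finite when [Phi] is log-concave. *)
Lemma iter_slice_le (n : nat) (D : 'I_n -> set R) (f : 'I_n -> R -> R)
    (k : 'I_n -> nat) (Phi : R -> \bar R) (s : R) :
  (forall i, profile (D i) (f i)) -> level_fun Phi ->
  exists2 c : R, (0 <= c)%R & forall r : R, (r <= s)%R ->
    iter_slice D f k Phi r <= c%:E * iter_slice D f (fun=> 0%N) Phi r.
Proof.
move=> hD hPhi; elim: n => [|n IH] in D f k hD *.
  by exists 1%R => // r _; rewrite mul1e.
have [c c0 hc] := IH (fun i => D (lift ord0 i)) (fun i => f (lift ord0 i))
  (fun i => k (lift ord0 i)) (fun i => hD _).
rewrite /= power_weight0; apply: slice_power_le (hD ord0) _ _ c0 hc.
- by apply: iter_slice_level => // i; exact: hD.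
- by apply: iter_slice_level => // i; exact: hD.
Qed.

(** This says that the mean of the monomial is nondecreasing in the level. The induction varies
    [Phi], so that the layer slice of coordinate 0 can become part of it. *)
Lemma iter_slice_ratio (n : nat) (D : 'I_n -> set R) (f : 'I_n -> R -> R)
    (k : 'I_n -> nat) (Phi : R -> \bar R) (s s' : R) :
  (forall i, profile (D i) (f i)) -> log_concave_level Phi -> (s <= s')%R ->
  iter_slice D f k Phi s * iter_slice D f (fun=> 0%N) Phi s' <=
  iter_slice D f k Phi s' * iter_slice D f (fun=> 0%N) Phi s.
Proof.
move=> hD hPhi ss'; elim: n => [|n IH] in D f k Phi hPhi hD *.
  by rewrite /= muleC.
have hl := lc_level hPhi.
rewrite [iter_slice D f k Phi s]/= [iter_slice D f k Phi s']/=.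
set D' := fun i => D (lift ord0 i); set f' := fun i => f (lift ord0 i).
set k' := fun i => k (lift ord0 i).
have hD' i : profile (D' i) (f' i) by exact: hD.
have hX := iter_slice_level k' hD' hl.
have L0 j r : 0 <= iter_slice D f j Phi r.
  exact: level_ge0 (iter_slice_level j hD hl) r.
apply: (slice_layers_le (hD ord0) hX hX (L0 (fun=> 0%N) s')
  (L0 (fun=> 0%N) s)) => u; cbv zeta.
set U := D ord0 `&` _.
have hU : profile U (f ord0) by exact: setI_profile_power.
have hPU : log_concave_level (slice_op (\1_U) (f ord0) Phi).
  exact: slice_log_concave.
have hT := iter_slice_log_concave hD' hPhi.
(* Moved to the innermost place, the layer slice yields a new log-concave base, to which the
   induction hypothesis applies. *)
have commU j : slice_op (\1_U) (f ord0) (iter_slice D' f' j Phi) =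
    iter_slice D' f' j (slice_op (\1_U) (f ord0) Phi).
  by have := iter_slice_comm j 0 hD' hU hl; rewrite power_weight0.
have AB := IH D' f' k' _ hPU hD'.
have BC : slice_op (\1_U) (f ord0) (iter_slice D' f' (fun=> 0%N) Phi) s *
    iter_slice D f (fun=> 0%N) Phi s' <=
    slice_op (\1_U) (f ord0) (iter_slice D' f' (fun=> 0%N) Phi) s' *
    iter_slice D f (fun=> 0%N) Phi s.
  by have := slice_prefix_ratio (k ord0) u (hD ord0) hT ss'; rewrite /= power_weight0.
rewrite !commU in BC *.
have hB := iter_slice_log_concave hD' hPU.
have [c c0 hc] := iter_slice_le k' s' hD' (lc_level hPU).
(* The ratio A / C factors as (A / B) * (B / C), both factors being
   nondecreasing; A vanishes wherever B does. *)
set A := iter_slice D' f' k' _ in AB hc *.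
set B := iter_slice D' f' (fun=> 0%N) _ in AB BC hc hB *.
set C := iter_slice D f _ _ in BC *.
have A0 r : 0 <= A r.
  by apply: level_ge0; apply: iter_slice_level => //; exact: lc_level.
have C0 r : 0 <= C r by exact: L0.
have B0 r : 0 <= B r by exact: level_ge0 (lc_level hB) r.
have [Bs0|Bs_neq0] := eqVneq (B s) 0.
  have : A s <= 0 by rewrite (le_trans (hc _ ss'))// Bs0 mule0.
  move=> As0; rewrite (_ : A s = 0) ?mul0e ?mule_ge0//.
  by apply/eqP; rewrite eq_le As0 A0.
have Bs : 0 < B s by rewrite lt0e Bs_neq0 B0.
have Bs' : 0 < B s' by exact: lt_le_trans Bs (level_nd (lc_level hB) ss').
have Bfin : B s * B s' \is a fin_num by rewrite fin_numM// lc_fin.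
rewrite -(lee_pmul2r Bfin) ?mule_gt0//.
rewrite (_ : A s * C s' * (B s * B s') = (A s * B s') * (B s * C s')); last first.
  by rewrite muleACA (muleC (B s)) muleACA [X in _ * X]muleC muleACA.
rewrite (_ : A s' * C s * (B s * B s') = (A s' * B s) * (B s' * C s)); last first.
  by rewrite muleACA [C s * _]muleC.
by apply: lee_pmul => //; apply: mule_ge0.
Qed.

Lemma power_slice_chebyshev (D : set R) (f : R -> R) (k : nat)
    (Phi Psi : R -> \bar R) (s : R) :
  profile D f -> level_fun Phi -> level_fun Psi ->
  (forall r r', (r <= r')%R -> Psi r * Phi r' <= Psi r' * Phi r) ->
  slice_op (power_weight D k) f Psi s * slice_op (\1_D) f Phi s <=
  slice_op (power_weight D k) f Phi s * slice_op (\1_D) f Psi s.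
Proof.
move=> hD hPhi hPsi ratio; apply: slice_layers_le => //.
- by rewrite -power_weight0; exact: level_ge0 (power_slice_level 0 hD hPhi) s.
- by rewrite -power_weight0; exact: level_ge0 (power_slice_level 0 hD hPsi) s.
- by move=> u; exact: slice_prefix_chebyshev.
Qed.

(** Divided by the power [n + 1] of the unweighted slice, this is the inequality between the mean of
    the product and the product of the means. *)
Lemma iter_slice_sub_product (n : nat) (D : 'I_n -> set R)
    (f : 'I_n -> R -> R) (k : 'I_n -> nat) (Phi : R -> \bar R) (s : R) :
  (forall i, profile (D i) (f i)) -> log_concave_level Phi ->
  iter_slice D f k Phi s * iter_slice D f (fun=> 0%N) Phi s ^+ n <=
  iter_slice D f (fun=> 0%N) Phi s *
    \prod_(i < n) iter_slice D f (fun j => if j == i then k j else 0%N) Phi s.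
Proof.
move=> hD hPhi; elim: n => [|n IH] in D f k Phi hPhi hD *.
  by rewrite /= big_ord0.
have hl := lc_level hPhi.
pose D' := fun i => D (lift ord0 i); pose f' := fun i => f (lift ord0 i).
pose k' := fun i => k (lift ord0 i).
have hD' i : profile (D' i) (f' i) by exact: hD.
have hPhi' : log_concave_level (slice_op (\1_(D ord0)) (f ord0) Phi).
  exact: slice_log_concave.
have comm0 j : slice_op (\1_(D ord0)) (f ord0) (iter_slice D' f' j Phi) =
    iter_slice D' f' j (slice_op (\1_(D ord0)) (f ord0) Phi).
  by have := iter_slice_comm j 0 hD' (hD ord0) hl; rewrite power_weight0.
(* Integrating coordinate 0 into the base keeps the total mass, so the induction hypothesis carries
   the same [V]. *)
have VE : iter_slice D f (fun=> 0%N) Phi =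
    iter_slice D' f' (fun=> 0%N) (slice_op (\1_(D ord0)) (f ord0) Phi).
  by rewrite -comm0 /= power_weight0.
have := IH D' f' k' _ hPhi' hD'; rewrite -VE => IHn.
rewrite big_ord_recl.
set V := iter_slice D f (fun=> 0%N) Phi s in IHn *.
set C := iter_slice D f (fun j => if j == ord0 then k j else 0%N) Phi s.
have CE : C = slice_op (power_weight (D ord0) (k ord0)) (f ord0)
    (iter_slice D' f' (fun=> 0%N) Phi) s by [].
set P' := \prod_(i < n) _ in IHn.
have PE : \prod_(i < n) iter_slice D f
    (fun j => if j == lift ord0 i then k j else 0%N) Phi s = P'.
  apply: eq_bigr => i _; rewrite /= -/D' -/f' power_weight0 comm0.
  congr (iter_slice _ _ _ _ s); apply/funext => j.
rewrite PE.
have pos j : 0 <= iter_slice D f j Phi s.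
  exact: level_ge0 (iter_slice_level j hD hl) s.
(* Chebyshev splits off coordinate 0; its hypothesis is the monotone ratio of [iter_slice_ratio] for
   the remaining coordinates. *)
have cheb : iter_slice D f k Phi s * V <=
    C * iter_slice D' f' k' (slice_op (\1_(D ord0)) (f ord0) Phi) s.
  rewrite -comm0 CE /V /= power_weight0; apply: power_slice_chebyshev => //.
  - exact: iter_slice_level.
  - exact: iter_slice_level.
  - by move=> r r' rr'; exact: iter_slice_ratio.
set E := iter_slice D' f' k' _ s in IHn cheb *.
have E0 : 0 <= E.
  by rewrite /E; apply: level_ge0; apply: iter_slice_level => //; exact: lc_level.
rewrite expeS muleA.
apply: (@le_trans _ _ (C * E * V ^+ n)).
  by apply: lee_wpmul2r => //; apply: expe_ge0; exact: pos.
by rewrite -muleA (muleCA V); apply: lee_wpmul2l => //; exact: pos.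
Qed.

End iter_slice_theory.

(** * Orlicz balls as iterated slices *)

Section young_profile.
Variables (R : realType) (F : R -> \bar R).
Hypothesis hF : young_function F.

(** The value 0 on the negative half-line makes the function nondecreasing on all of [R], hence
    measurable. *)
Definition young_ext (x : R) : \bar R := if (x < 0)%R then 0 else F x.
Definition young_dom : set R := [set x | (0 <= x)%R /\ young_ext x < +oo].
(* Since [fine +oo = 0], [young_real] carries no information outside
   [young_dom]. *)
Definition young_real (x : R) : R := fine (young_ext x).

Lemma young_extE x : (0 <= x)%R -> young_ext x = F x.
Proof. by move=> x0; rewrite /young_ext ltNge x0. Qed.

(** Convexity between [x] and 0, where [F] vanishes. Monotonicity and at least linear growth both
    follow from it. *)
Lemma young_scale (x t : R) : (0 <= x)%R -> (0 <= t <= 1)%R ->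
  F (t * x)%R <= t%:E * F x.
Proof.
move=> x0 t01; have := young_convex hF x0 (lexx 0%R) t01.
by rewrite mulr0 addr0 (young0 hF) mule0 adde0.
Qed.

Lemma young_ext_ge0 x : 0 <= young_ext x.
Proof.
by rewrite /young_ext; case: ltP => // x0; exact: young_ge0 hF _ x0.
Qed.

Lemma young_ext_nd (x y : R) : (x <= y)%R -> young_ext x <= young_ext y.
Proof.
move=> xy; have [x0|x0] := ltP x 0%R.
  by rewrite {1}/young_ext x0; exact: young_ext_ge0.
have y0 := le_trans x0 xy; rewrite !young_extE//.
move: (y0); rewrite le_eqVlt => /orP[/eqP y0'|yp].
  by rewrite (_ : x = y)//; apply/eqP; rewrite eq_le xy -y0'.
have t01 : (0 <= x / y <= 1)%R by rewrite divr_ge0//= ler_pdivrMr// mul1r.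
have := young_scale y0 t01; rewrite divfK ?gt_eqF// => /le_trans; apply.
rewrite -[leRHS]mul1e; apply: lee_wpmul2r; first exact: young_ge0 hF _ y0.
by rewrite lee_fin; case/andP: t01.
Qed.

Lemma measurable_young_ext : measurable_fun [set: R] young_ext.
Proof. exact: nondecreasing_emeasurable young_ext_nd. Qed.

Lemma young_realK (x : R) : young_ext x < +oo -> (young_real x)%:E = young_ext x.
Proof. by move=> xoo; rewrite fineK// ge0_fin_numE// young_ext_ge0. Qed.

Lemma young_dom_convex (x y t : R) : young_dom x -> young_dom y ->
  (0 < t < 1)%R ->
  young_dom (t * x + (1 - t) * y)%R /\
  (young_real (t * x + (1 - t) * y) <= t * young_real x + (1 - t) * young_real y)%R.
Proof.
move=> [x0 xoo] [y0 yoo] /andP[t0 t1].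
have t01 : (0 <= t <= 1)%R by rewrite !ltW.
have t1' : (0 <= 1 - t)%R by rewrite subr_ge0 ltW.
have z0 : (0 <= t * x + (1 - t) * y)%R.
  by rewrite addr_ge0// mulr_ge0// ltW.
have := young_convex hF x0 y0 t01.
rewrite -!young_extE// -!(young_realK xoo) -!(young_realK yoo).
rewrite -!EFinM -EFinD => hz.
have zoo : young_ext (t * x + (1 - t) * y)%R < +oo.
  by apply: le_lt_trans hz _; rewrite ltry.
split; first by split.
by rewrite -lee_fin (young_realK zoo).
Qed.

Lemma young_profile : profile young_dom young_real.
Proof.
split.
- apply: is_interval_measurable => x y [x0 _] [_ yoo] z /andP[xz zy].
  split; first exact: le_trans x0 xz.
  exact: le_lt_trans (young_ext_nd zy) yoo.
- apply: (measurableT_comp (f := fine)); first exact: fine_measurable.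
  exact: measurable_young_ext.
- by move=> x [].
- by move=> x; apply: fine_ge0; exact: young_ext_ge0.
- move=> x y [_ xoo] [_ yoo] xy.
  by rewrite -lee_fin !young_realK//; exact: young_ext_nd.
- by move=> x y t Dx Dy t01; have [] := young_dom_convex Dx Dy t01.
- by move=> x y t Dx Dy t01; have [] := young_dom_convex Dx Dy t01.
move=> s; have [x0 x00 Fx0] := young_neq0 hF.
(* For [x > x0] in the domain, [F x0 <= (x0 / x) * F x] gives [x <= x0 * s / F x0]. The sum covers
   also [x <= x0], and the absolute value keeps the bound nonnegative when [s < 0]. *)
exists (x0 + `|x0 * s / young_real x0|)%R; first by rewrite addr_ge0.
move=> x [xge0 xoo] fxs; have [xx0|x0x] := leP x x0.
  by rewrite (le_trans xx0)// lerDl.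
have xp : (0 < x)%R by exact: le_lt_trans x0x.
have t01 : (0 <= x0 / x <= 1)%R by rewrite divr_ge0//= ler_pdivrMr// mul1r ltW.
have := young_scale xge0 t01; rewrite divfK ?gt_eqF//.
rewrite -!young_extE// -(young_realK xoo).
have x0oo : young_ext x0 < +oo := le_lt_trans (young_ext_nd (ltW x0x)) xoo.
rewrite -(young_realK x0oo) -EFinM lee_fin => h.
have f0 : (0 < young_real x0)%R.
  rewrite lt0r; apply/andP; split.
    by rewrite -(eqe _ 0%R) young_realK// young_extE.
  by apply: fine_ge0; exact: young_ext_ge0.
apply: (@le_trans _ _ (x0 * s / young_real x0)%R).
  rewrite ler_pdivlMr// mulrC -ler_pdivlMr//; apply: le_trans h _.
  by rewrite mulrAC ler_wpM2r ?invr_ge0// ler_wpM2l.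
by rewrite (le_trans (ler_norm _))// lerDr.
Qed.

End young_profile.

Definition step_level (R : realType) (s : R) : \bar R := ((0 <= s)%R%:R)%:E.

Lemma step_log_concave (R : realType) : log_concave_level (@step_level R).
Proof.
split.
- split.
  + by move=> s; rewrite lee_fin.
  + move=> s s' ss'; rewrite lee_fin ler_nat.
    by case: (leP 0%R s) => // s0; rewrite (le_trans s0 ss').
  + by move=> s s0; rewrite /step_level leNgt s0.
- by [].
move=> s s' t /andP[t0 t1] /=.
have [s0|s0] := leP 0%R s; last by rewrite powR0 ?mul0r ?ler0n// gt_eqF.
have [s'0|s'0] := leP 0%R s'; last first.
  by rewrite (@powR0 _ (1 - t)%R) ?mulr0 ?ler0n// gt_eqF// subr_gt0.
rewrite !powR1 mulr1 (_ : (0 <= _)%R = true)// addr_ge0// mulr_ge0// ?ltW//.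
by rewrite subr_gt0.
Qed.

(** * Lebesgue measure on tuples: iterated integrals and sign flips *)

Lemma measurable_tcons (R : realType) (n : nat) :
  measurable_fun setT
    (@tcons R n : measurableTypeR R * n.-tuple R -> n.+1.-tuple R).
Proof. exact: measurable_cons. Qed.

Lemma integral_lebesgue_tuple0 (R : realType) (F : 0.-tuple R -> \bar R) :
  measurable_fun [set: 0.-tuple R] F ->
  \int[@lebesgue_tuple R 0]_t F t = F [tuple].
Proof.
move=> mF; rewrite (eq_measure_integral (\d_([tuple] : 0.-tuple R)))//.
by rewrite integral_dirac// diracT mul1e.
Qed.

Lemma integral_lebesgue_tupleS (R : realType) (n : nat)
    (F : n.+1.-tuple R -> \bar R) :
  measurable_fun [set: n.+1.-tuple R] F -> (forall t, 0 <= F t) ->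
  \int[@lebesgue_tuple R n.+1]_t F t =
  \int[lebesgue_measure]_x \int[@lebesgue_tuple R n]_t F (tcons (x, t)).
Proof.
move=> mF F0.
have mFt : measurable_fun setT
    (F \o @tcons R n : measurableTypeR R * n.-tuple R -> \bar R).
  apply: measurableT_comp; first exact: mF.
  exact: measurable_tcons.
have F0t p : 0 <= (F \o @tcons R n) p by exact: F0.
rewrite -(fubini_tonelli1 _ mFt F0t).
pose nu := measure_function_pushforward__canonical__measure_function_Measure
  (@lebesgue_measure R \x @lebesgue_tuple R n) (@measurable_tcons R n).
rewrite (eq_measure_integral nu)//.
by rewrite ge0_integral_pushforward//; exact: measurable_tcons.
Qed.

Lemma integral_reflect (R : realType) (g : R -> \bar R) :
  measurable_fun [set: R] g -> (forall x, 0 <= g x) ->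
  \int[lebesgue_measure]_x g (- x)%R = \int[lebesgue_measure]_x g x.
Proof.
move=> mg g0; transitivity (\int[pushforward lebesgue_measure
    (-%R : measurableTypeR R -> measurableTypeR R)]_x g x).
  by rewrite ge0_integral_pushforward//= preimage_setT.
by apply: eq_measure_integral => A mA _; exact: lebesgue_measureN.
Qed.

(** Each half-line contributes one copy of the integral of [g]; repeated over the coordinates, this
    is the origin of the factor [2 ^+ n]. *)
Lemma integral_abs_supported (R : realType) (g : R -> \bar R) :
  measurable_fun [set: R] g -> (forall x, 0 <= g x) ->
  (forall x, (x < 0)%R -> g x = 0) ->
  \int[lebesgue_measure]_x g `|x|%R = 2%:E * \int[lebesgue_measure]_x g x.
Proof.
move=> mg g0 gneg.
have mabs : measurable_fun [set: R] (fun x : R => g `|x|%R).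
  by apply: (measurableT_comp (f := g)) => //.
have TE : [set: R] = `]-oo, 0%R[ `|` `[0%R, +oo[.
  apply/seteqP; split => // x _ /=; rewrite !in_itv/= andbT.
  by have [_|_] := ltP x 0%R; [left|right].
have disj : [disjoint (`]-oo, 0%R[%classic : set R) & (`[0%R, +oo[)%classic].
  apply/disj_setPS => x [] /=; rewrite !in_itv/= andbT => x0.
  by rewrite leNgt x0.
have splitT (h : R -> \bar R) : measurable_fun [set: R] h ->
    (forall x, 0 <= h x) -> \int[lebesgue_measure]_x h x =
    \int[lebesgue_measure]_(x in `]-oo, 0%R[) h x +
    \int[lebesgue_measure]_(x in `[0%R, +oo[) h x.
  move=> mh h0; rewrite -ge0_integral_setU//= -?TE//; exact: measurable_itv.
have posE : \int[lebesgue_measure]_x g x =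
    \int[lebesgue_measure]_(x in `[0%R, +oo[) g x.
  by rewrite splitT// [X in X + _]integral0_eq ?add0e.
rewrite splitT// posE mule_natl mule2n; congr (_ + _); last first.
  by apply: eq_integral => x /set_mem/=; rewrite in_itv/= andbT => /ger0_norm ->.
rewrite integral_itv_bndo_bndc; last exact: measurable_funTS.
rewrite ge0_integration_by_substitution0//.
apply: eq_integral => x /set_mem/=; rewrite in_itv/= => x0.
by rewrite ler0_norm.
Qed.

Definition tuple_flip (R : realType) (n : nat) (e : 'I_n -> bool)
    (t : n.-tuple R) : n.-tuple R :=
  [tuple (if e i then - tnth t i else tnth t i)%R | i < n].

Lemma measurable_tuple_flip (R : realType) (n : nat) (e : 'I_n -> bool) :
  measurable_fun setT (@tuple_flip R n e : n.-tuple R -> n.-tuple R).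
Proof.
apply/measurable_fun_tnthP => i.
rewrite (_ : _ \o _ = fun t : n.-tuple R =>
    if e i then (- tnth t i)%R else tnth t i); last first.
  by apply/funext => t /=; rewrite tnth_mktuple.
case: (e i); last exact: measurable_tnth.
by apply: measurable_funN; exact: measurable_tnth.
Qed.

Lemma tuple_flip_cons (R : realType) (n : nat) (e : 'I_n.+1 -> bool) (x : R)
    (t : n.-tuple R) :
  tuple_flip e (tcons (x, t)) =
  tcons ((if e ord0 then - x else x)%R, tuple_flip (fun i => e (lift ord0 i)) t).
Proof.
apply: eq_from_tnth => i; rewrite tnth_mktuple.
case: (unliftP ord0 i) => [j ->|->//].
by rewrite !tnthS tnth_mktuple.
Qed.

Lemma integral_lebesgue_tuple_flip (R : realType) (n : nat) (e : 'I_n -> bool)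
    (F : n.-tuple R -> \bar R) :
  measurable_fun [set: n.-tuple R] F -> (forall t, 0 <= F t) ->
  \int[@lebesgue_tuple R n]_t F (tuple_flip e t) =
  \int[@lebesgue_tuple R n]_t F t.
Proof.
elim: n => [|n IH] in e F * => mF F0.
  apply: eq_integral => t _; congr F.
  by rewrite (tuple0 (tuple_flip e t)) (tuple0 t).
have mFe : measurable_fun [set: n.+1.-tuple R] (fun t => F (tuple_flip e t)).
  by apply: measurableT_comp; [exact: mF|exact: measurable_tuple_flip].
rewrite !integral_lebesgue_tupleS//.
have mcons (x : R) :
    measurable_fun [set: n.-tuple R] (fun t => F (tcons (x, t))).
  apply: measurableT_comp; first exact: mF.
  by apply: measurable_cons; [exact: measurable_cst|exact: measurable_id].
pose G (x : R) := \int[@lebesgue_tuple R n]_t F (tcons (x, t)).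
have mG : measurable_fun [set: R] G.
  apply: (measurable_fun_fubini_tonelli_F
    (F \o @tcons R n : measurableTypeR R * n.-tuple R -> \bar R)).
    by apply: measurableT_comp; [exact: mF|exact: measurable_tcons].
  by move=> p; exact: F0.
have G0 x : 0 <= G x by apply: integral_ge0 => t _; exact: F0.
transitivity (\int[lebesgue_measure]_x G (if e ord0 then - x else x)%R).
  apply: eq_integral => x _; rewrite /G.
  rewrite -[RHS](IH (fun i => e (lift ord0 i)))//.
  by apply: eq_integral => t _; rewrite tuple_flip_cons.
by case: (e ord0) => //; exact: integral_reflect.
Qed.

(** Level 1 is [orlicz_ball]; the other levels arise when coordinates are sliced off. *)
Definition orlicz_level (R : realType) (n : nat) (F : 'I_n -> R -> \bar R)
    (s : R) : set (n.-tuple R) :=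
  [set t | \sum_(i < n) F i `|tnth t i|%R <= s%:E].

Lemma measurable_orlicz_level (R : realType) (n : nat)
    (F : 'I_n -> R -> \bar R) (s : R) : (forall i, young_function (F i)) ->
  measurable (orlicz_level F s).
Proof.
move=> hF; pose S (t : n.-tuple R) := \sum_(i < n) young_ext (F i) `|tnth t i|%R.
have mS : measurable_fun [set: n.-tuple R] S.
  apply: emeasurable_sum => i.
  apply: (measurableT_comp (f := young_ext (F i))).
    exact: measurable_young_ext.
  apply: measurableT_comp; first exact: normr_measurable.
  exact: measurable_tnth.
have := emeasurable_fun_infty_c measurableT mS s%:E; rewrite setTI.
rewrite (_ : [set x | _] = orlicz_level F s)//.
have SE t : S t = \sum_(i < n) F i `|tnth t i|%R.
  by apply: eq_bigr => i _; rewrite young_extE.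
by apply/seteqP; split => t; rewrite /orlicz_level/= SE.
Qed.

Lemma tnth_tcons0 (T : Type) (n : nat) (x : T) (t : n.-tuple T) :
  tnth (tcons (x, t)) ord0 = x.
Proof. by []. Qed.

Lemma tnth_tconsS (T : Type) (n : nat) (x : T) (t : n.-tuple T) (i : 'I_n) :
  tnth (tcons (x, t)) (lift ord0 i) = tnth t i.
Proof. by rewrite tnthS. Qed.

(** The remaining sum is nonnegative, so the first term is at most [s], hence finite, and can be
    subtracted. *)
Lemma orlicz_level_cons (R : realType) (n : nat) (F : 'I_n.+1 -> R -> \bar R)
    (s x : R) (t : n.-tuple R) : (forall i, young_function (F i)) ->
  orlicz_level F s (tcons (x, t)) <->
  young_dom (F ord0) `|x|%R /\
  orlicz_level (fun i => F (lift ord0 i)) (s - young_real (F ord0) `|x|)%R t.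
Proof.
move=> hF; rewrite /orlicz_level/= big_ord_recl tnth_tcons0.
set S := \sum_(i < n) F (lift ord0 i) `|tnth t i|%R.
rewrite (eq_bigr (fun i => F (lift ord0 i) `|tnth t i|%R)) -/S; last first.
  by move=> i _; rewrite tnth_tconsS.
have S0 : 0 <= S by apply: sume_ge0 => i _; exact: young_ge0 (hF _) _ (normr_ge0 _).
have Fx0 : 0 <= F ord0 `|x|%R by exact: young_ge0 (hF _) _ (normr_ge0 _).
rewrite /young_dom /young_real /= young_extE//.
split.
  move=> le_s; have Fxoo : F ord0 `|x|%R < +oo.
    apply: le_lt_trans (ltry s); apply: le_trans le_s; exact: leeDl.
  split; first by split.
  rewrite EFinB fineK ?ge0_fin_numE// leeBrDl//.
  by rewrite ge0_fin_numE.
move=> [[_ Fxoo]]; rewrite EFinB fineK ?ge0_fin_numE// leeBrDl//.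
by rewrite ge0_fin_numE.
Qed.

Lemma measurable_monomial (R : realType) (n : nat) (k : 'I_n -> nat) :
  measurable_fun [set: n.-tuple R]
    (fun t : n.-tuple R => (\prod_(i < n) tnth t i ^+ k i)%R).
Proof.
apply: measurable_prod => i _; apply: measurable_funX; exact: measurable_tnth.
Qed.

Lemma monomial_ge0 (R : realType) (n : nat) (k : 'I_n -> nat) (x : 'I_n -> R) :
  (forall i, ~~ odd (k i)) -> (0 <= \prod_(i < n) x i ^+ k i)%R.
Proof.
by move=> ek; apply: prodr_ge0 => i _; rewrite exprn_even_ge0.
Qed.

Lemma integral_orlicz_monomial (R : realType) (n : nat)
    (F : 'I_n -> R -> \bar R) (k : 'I_n -> nat) (s : R) :
  (forall i, young_function (F i)) -> (forall i, ~~ odd (k i)) ->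
  \int[@lebesgue_tuple R n]_t
    ((\prod_(i < n) tnth t i ^+ k i) * \1_(orlicz_level F s) t)%:E =
  (2 ^+ n)%:E * iter_slice (fun i => young_dom (F i))
    (fun i => young_real (F i)) k (@step_level R) s.
Proof.
elim: n => [|n IH] in F k s * => hF ek.
  rewrite integral_lebesgue_tuple0; last first.
    apply/measurable_EFinP; apply: measurable_funM; first exact: measurable_monomial.
    by apply: measurable_indic; exact: measurable_orlicz_level.
  rewrite big_ord0 mul1r mul1e/= /step_level indicE.
  have -> // : ([tuple] \in orlicz_level F s) = (0 <= s)%R.
  by apply/idP/idP => [/set_mem|s0]; [|apply/mem_set];
    rewrite /orlicz_level/= big_ord0 lee_fin.
rewrite integral_lebesgue_tupleS; first last.
- by move=> t; rewrite lee_fin mulr_ge0// monomial_ge0.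
- apply/measurable_EFinP; apply: measurable_funM; first exact: measurable_monomial.
  by apply: measurable_indic; exact: measurable_orlicz_level.
have hD i : profile (young_dom (F i)) (young_real (F i)) by exact: young_profile.
have hstep := step_log_concave R.
pose G := iter_slice (fun i => young_dom (F (lift ord0 i)))
  (fun i => young_real (F (lift ord0 i))) (fun i => k (lift ord0 i))
  (@step_level R).
have hG : level_fun G by apply: iter_slice_level => //; exact: lc_level.
pose w := power_weight (young_dom (F ord0)) (k ord0).
have w0 x : (0 <= w x)%R.
  by apply: power_weight_ge0; exact: profile_dom_ge0 (hD ord0).
have mw : measurable_fun [set: R] w.
  by apply: measurable_power_weight; exact: profile_meas (hD ord0).
pose g (x : R) := (2 ^+ n)%:E *
  ((w x)%:E * G (s - young_real (F ord0) x)%R).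
have mG : measurable_fun [set: R]
    (fun x => (w x)%:E * G (s - young_real (F ord0) x)%R).
  by apply: measurable_slice_integrand => //; exact: profile_mfun (hD ord0).
have G0 x : 0 <= (w x)%:E * G (s - young_real (F ord0) x)%R.
  by apply: mule_ge0; [rewrite lee_fin|exact: level_ge0].
(* The exponents being even, the inner integral depends on [x] only through its absolute value. *)
transitivity (\int[lebesgue_measure]_x g `|x|%R).
  apply: eq_integral => x _.
  have [xD|xD] := pselect (young_dom (F ord0) `|x|%R); last first.
    rewrite /g /w /power_weight indicE (memNset xD) mulr0 mul0e mule0.
    apply: integral0_eq => t _; rewrite indicE memNset ?mulr0//.
    by move=> /(orlicz_level_cons _ _ _ hF)[].
  have wE : w `|x|%R = (x ^+ k ord0)%R.
    rewrite /w /power_weight indicE mem_set// mulr1 -normrX ger0_norm//.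
    by rewrite exprn_even_ge0.
  rewrite /g muleCA -(IH (fun i => F (lift ord0 i)) (fun i => k (lift ord0 i)))//.
  rewrite -ge0_integralZl//; first last.
  - by rewrite lee_fin.
  - by move=> t _; rewrite lee_fin mulr_ge0// monomial_ge0.
  - apply/measurable_EFinP; apply: measurable_funM; first exact: measurable_monomial.
    by apply: measurable_indic; exact: measurable_orlicz_level.
  apply: eq_integral => t _; rewrite -EFinM; congr (_%:E).
  rewrite big_ord_recl tnth_tcons0 wE -mulrA.
  congr (_ * (_ * _))%R; first by apply: eq_bigr => i _; rewrite tnth_tconsS.
  rewrite !indicE; congr ((nat_of_bool _)%:R); apply/idP/idP => /set_mem h; apply/mem_set.
    by have /(orlicz_level_cons _ _ _ hF)[] := h.
  by apply/(orlicz_level_cons _ _ _ hF).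
rewrite integral_abs_supported//; first last.
- move=> x x0; rewrite /g /w /power_weight indicE memNset ?mulr0 ?mul0e ?mule0//.
  by move=> [xge0 _]; move: x0; rewrite ltNge xge0.
- by move=> x; rewrite /g mule_ge0// lee_fin exprn_ge0.
- exact: measurable_funeM.
have c0 : 0 <= (2 ^+ n)%:E :> \bar R by rewrite lee_fin exprn_ge0.
rewrite /g ge0_integralZl//.
by rewrite muleA -EFinM -exprS.
Qed.

Lemma mule_EFin_inj (R : realFieldType) (c : R) (x y : \bar R) : c != 0%R ->
  c%:E * x = c%:E * y -> x = y.
Proof.
by move=> c0 /(congr1 (fun z => c^-1%:E * z)); rewrite !muleA -EFinM mulVf// !mul1e.
Qed.

(** * Sign averaging and independence *)

(** A word [phi] picks an index from each of the [p] factors of the expanded power; its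
    multiplicities are the exponents of the resulting monomial. *)
Definition multiplicity (n p : nat) (phi : {ffun 'I_p -> 'I_n}) (i : 'I_n) : nat :=
  #|[pred j | phi j == i]|.

Definition even_word (n p : nat) (phi : {ffun 'I_p -> 'I_n}) : bool :=
  [forall i, ~~ odd (multiplicity phi i)].

Lemma sum_power_words (R : comNzRingType) (n p : nat) (y : 'I_n -> R) :
  ((\sum_(i < n) y i) ^+ p =
   \sum_(phi : {ffun 'I_p -> 'I_n}) \prod_(i < n) y i ^+ multiplicity phi i)%R.
Proof.
rewrite -[in LHS](card_ord p) -prodr_const bigA_distr_bigA/=.
apply: eq_bigr => phi _; rewrite (partition_big phi predT)//=.
apply: eq_bigr => i _; rewrite -prodr_const.
by apply: eq_big => j //; move=> /eqP ->.
Qed.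

(** For a fixed word the sum over signs factors into one term [1 + (-1) ^+ m] per coordinate, with
    [m] the multiplicity: 2 if [m] is even, 0 otherwise. *)
Lemma sum_signs_words (R : comNzRingType) (n p : nat) (y : 'I_n -> R) :
  (\sum_(e : {ffun 'I_n -> bool}) (\sum_(i < n) (-1) ^+ e i * y i) ^+ p =
   2 ^+ n * \sum_(phi : {ffun 'I_p -> 'I_n} | even_word phi)
     \prod_(i < n) y i ^+ multiplicity phi i)%R.
Proof.
under eq_bigr do rewrite sum_power_words.
rewrite exchange_big/= mulr_sumr [RHS]big_mkcond/=; apply: eq_bigr => phi _.
transitivity ((\prod_(i < n) \sum_(b : bool) (-1) ^+ (b * multiplicity phi i)) *
    \prod_(i < n) y i ^+ multiplicity phi i)%R.
  rewrite bigA_distr_bigA/= mulr_suml; apply: eq_bigr => e _.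
  rewrite -big_split/=; apply: eq_bigr => i _.
  by rewrite exprMn exprM.
case: ifPn => [/forallP phi_even|].
  congr (_ * _)%R; rewrite -[in RHS](card_ord n) -prodr_const.
  apply: eq_bigr => i _; rewrite big_bool mul1n mul0n expr0 -signr_odd.
  by rewrite (negbTE (phi_even i)).
rewrite negb_forall => /existsP[i]; rewrite negbK => odd_i.
rewrite (bigD1 i)//= big_bool mul1n mul0n expr0 -signr_odd odd_i expr1.
by rewrite /= addNr !mul0r.
Qed.

(** Flip invariance is an abstract hypothesis so that the expansion serves both the uniform vector
    and the vector of independent copies. *)
Lemma expectation_even_words (R : realType) (n p : nat) (a : 'I_n -> R)
    (d : measure_display) (T : measurableType d) (P : probability T R)
    (X : T -> n.-tuple R) :
  ~~ odd p -> measurable_fun [set: T] X ->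
  (forall (e : 'I_n -> bool) (H : n.-tuple R -> R),
    measurable_fun [set: n.-tuple R] H -> (forall t, 0 <= H t)%R ->
    \int[P]_w (H (tuple_flip e (X w)))%:E = \int[P]_w (H (X w))%:E) ->
  \int[P]_w ((\sum_(i < n) a i * tnth (X w) i) ^+ p)%:E =
  \sum_(phi : {ffun 'I_p -> 'I_n} | even_word phi)
    (\prod_(i < n) a i ^+ multiplicity phi i)%:E *
    \int[P]_w (\prod_(i < n) tnth (X w) i ^+ multiplicity phi i)%:E.
Proof.
move=> p_even mX sym.
pose H (t : n.-tuple R) : R := ((\sum_(i < n) a i * tnth t i) ^+ p)%R.
have mH : measurable_fun [set: n.-tuple R] H.
  apply: measurable_funX; apply: measurable_sum => i.
  by apply: measurable_funM => //; exact: measurable_tnth.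
have H0 t : (0 <= H t)%R by exact: exprn_even_ge0.
pose M phi (w : T) : R := (\prod_(i < n) tnth (X w) i ^+ @multiplicity n p phi i)%R.
have mM phi : measurable_fun [set: T] (M phi).
  by apply: (measurableT_comp (@measurable_monomial R n _) mX).
have M0 phi w : even_word phi -> (0 <= M phi w)%R.
  by move=> /forallP ephi; exact: monomial_ge0.
have A0 phi : even_word phi ->
    (0 <= \prod_(i < n) a i ^+ @multiplicity n p phi i)%R.
  by move=> /forallP ephi; exact: monomial_ge0.
have pointwise w : (\sum_(e : {ffun 'I_n -> bool}) H (tuple_flip e (X w)) =
    2 ^+ n * \sum_(phi : {ffun 'I_p -> 'I_n} | even_word phi)
      (\prod_(i < n) a i ^+ multiplicity phi i) * M phi w)%R.
  transitivity (\sum_(e : {ffun 'I_n -> bool})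
      (\sum_(i < n) (-1) ^+ e i * (a i * tnth (X w) i)) ^+ p)%R.
    apply: eq_bigr => e _; rewrite /H; congr (_ ^+ _)%R; apply: eq_bigr => i _.
    by rewrite tnth_mktuple; case: (e i); rewrite ?expr1 ?expr0 ?mul1r ?mulN1r ?mulrN.
  rewrite sum_signs_words; congr (_ * _)%R; apply: eq_bigr => phi _.
  by rewrite /M -big_split/=; apply: eq_bigr => i _; rewrite exprMn.
have sumH : \int[P]_w (\sum_(e : {ffun 'I_n -> bool}) H (tuple_flip e (X w)))%R%:E =
    (2 ^+ n)%:E * \int[P]_w (H (X w))%:E.
  transitivity (\int[P]_w \sum_(e : {ffun 'I_n -> bool}) (H (tuple_flip e (X w)))%:E).
    by apply: eq_integral => w _; rewrite sumEFin.
  have mHe (e : {ffun 'I_n -> bool}) :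
      measurable_fun [set: T] (fun w => (H (tuple_flip e (X w)))%:E).
    apply/measurable_EFinP; apply: measurableT_comp => //.
    by apply: measurableT_comp => //; exact: measurable_tuple_flip.
  rewrite (ge0_integral_sum P measurableT mHe); last first.
    by move=> e w _; rewrite lee_fin.
  under eq_bigr => e _ do rewrite sym//.
  rewrite (eq_bigr (fun=> 1%:E * \int[P]_w (H (X w))%:E)); last first.
    by move=> e _; rewrite mul1e.
  rewrite -ge0_sume_distrl ?sumEFin; last by move=> e _; rewrite lee_fin.
  by rewrite sumr_const card_ffun card_bool card_ord natrX.
(* Words that are not even get 0 rather than their monomial, which may be negative, so the sum over
   all words is a sum of nonnegative functions. *)
pose N phi w : R := if @even_word n p phi then
  ((\prod_(i < n) a i ^+ multiplicity phi i) * M phi w)%R else 0%R.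
have mN phi : measurable_fun [set: T] (fun w => (N phi w)%:E).
  apply/measurable_EFinP; rewrite /N; case: (even_word phi); last exact: measurable_cst.
  by apply: measurable_funM => //; exact: measurable_cst.
have N0 phi w : setT w -> 0 <= (N phi w)%:E.
  move=> _; rewrite lee_fin /N; case: ifP => // ephi.
  by rewrite mulr_ge0// ?A0// M0.
have sumN : \int[P]_w (\sum_(phi : {ffun 'I_p -> 'I_n} | even_word phi)
      (\prod_(i < n) a i ^+ multiplicity phi i) * M phi w)%R%:E =
    \sum_(phi : {ffun 'I_p -> 'I_n} | even_word phi)
      (\prod_(i < n) a i ^+ multiplicity phi i)%:E * \int[P]_w (M phi w)%:E.
  transitivity (\int[P]_w \sum_(phi : {ffun 'I_p -> 'I_n}) (N phi w)%:E).
    by apply: eq_integral => w _; rewrite sumEFin; congr (_%:E); rewrite big_mkcond.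
  rewrite (ge0_integral_sum P measurableT mN N0) [RHS]big_mkcond/=.
  apply: eq_bigr => phi _; rewrite /N.
  have [ephi|_] := boolP (even_word phi); last by rewrite integral0.
  under eq_integral do rewrite EFinM.
  rewrite ge0_integralZl//.
  - exact/measurable_EFinP.
  - by move=> w _; rewrite lee_fin M0.
  - by rewrite lee_fin A0.
have c0 : (2 ^+ n != 0 :> R)%R by rewrite expf_neq0.
apply: (mule_EFin_inj c0); rewrite -sumH -sumN.
under eq_integral do rewrite pointwise EFinM.
rewrite ge0_integralZl//.
- apply: (eq_measurable_fun (fun w => \sum_(phi : {ffun 'I_p -> 'I_n}) (N phi w)%:E)).
    by move=> w _; rewrite sumEFin; congr (_%:E); rewrite [RHS]big_mkcond.
  by apply: emeasurable_sum => phi; exact: mN.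
- move=> w _; rewrite lee_fin; apply: sumr_ge0 => phi ephi.
  by rewrite mulr_ge0// ?A0// M0.
Qed.

Section independence.
Variables (R : realType) (n : nat).
Variables (d : measure_display) (T : measurableType d) (P : probability T R).
Variable Y : 'I_n -> {RV P >-> R}.
Hypothesis indepY : mutually_independent Y.

Let mY i : measurable_fun [set: T] (Y i : T -> R).
Proof. exact: measurable_funPT. Qed.

Lemma independent_box (B : 'I_n -> set R) : (forall i, measurable (B i)) ->
  P [set w | forall i, B i (Y i w)] = \prod_(i < n) P (Y i @^-1` B i).
Proof.
move=> mB; have := indepY [set: 'I_n]%SET mB.
rewrite (eq_bigl predT) => [<-|i]; last by rewrite inE.
congr (P _); apply/seteqP; split => w /= h i; first by move=> _; exact: h.
by apply: h; rewrite /= inE.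
Qed.

Lemma independent_integral_prod (g : 'I_n -> R -> R) :
  (forall i, measurable_fun [set: R] (g i)) -> (forall i x, 0 <= g i x)%R ->
  \int[P]_w (\prod_(i < n) g i (Y i w))%:E =
  \prod_(i < n) \int[P]_w (g i (Y i w))%:E.
Proof.
(* The product rule passes from indicators to functions one coordinate at a
   time, through the layers [{u < h x}] of that coordinate. *)
have main (m : nat) (h : 'I_n -> R -> R) :
    (forall i, measurable_fun [set: R] (h i)) -> (forall i x, 0 <= h i x)%R ->
    (forall i : 'I_n, (m <= i)%N -> exists2 B : set R, measurable B & h i = \1_B) ->
    \int[P]_w (\prod_(i < n) h i (Y i w))%:E =
    \prod_(i < n) \int[P]_w (h i (Y i w))%:E; last first.
  move=> mg g0; apply: (main n) => // i.
  by rewrite leqNgt ltn_ord.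
elim: m h => [|m IH] h mh h0 hind.
  have hB i : exists B : set R, measurable B /\ h i = \1_B.
    by have [B mB hB] := hind i isT; exists B.
  have [B hBi] := choice hB.
  have mB i : measurable (B i) by have [] := hBi i.
  have mpre i : measurable (Y i @^-1` B i).
    by rewrite -[X in measurable X]setTI; exact: mY.
  have hE i w : h i (Y i w) = \1_(Y i @^-1` B i) w by have [_ ->] := hBi i.
  transitivity (P [set w | forall i, B i (Y i w)]).
    transitivity (\int[P]_w (\1_[set w | forall i, B i (Y i w)] w)%:E).
      apply: eq_integral => w _; congr (_%:E).
      rewrite [RHS]indicE; have [/set_mem Bw|nBw] := boolP (w \in _).
        rewrite big1// => i _; rewrite hE indicE mem_set//; exact: Bw.
      have [i nBi] : exists i, ~ B i (Y i w).
        apply/existsNP => Bw; move/negP: nBw; apply; exact/mem_set.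
      by rewrite (bigD1 i)//= hE indicE memNset// mul0r.
    rewrite integral_indic ?setIT//.
    rewrite (_ : mkset _ = \bigcap_(i in [set: 'I_n]) (Y i @^-1` B i)).
      by apply: fin_bigcap_measurable => // i _; exact: mpre.
    by apply/seteqP; split => w /= h' i; [move=> _; exact: h'|exact: h'].
  rewrite independent_box//; apply: eq_bigr => i _.
  under eq_integral do rewrite hE.
  by rewrite integral_indic// setIT.
have [nm|mn] := leqP n m.
  by apply: IH => // i mi; move: (ltn_ord i); rewrite ltnNge (leq_trans nm mi).
pose i0 := Ordinal mn.
pose Z (w : T) : R := (\prod_(i < n | i != i0) h i (Y i w))%R.
have mhY i : measurable_fun [set: T] (fun w => h i (Y i w)).
  exact: measurableT_comp (mh i) (mY i).
have mZ : measurable_fun [set: T] (fun w => (Z w)%:E).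
  apply/measurable_EFinP.
  rewrite (_ : Z = fun w => \prod_(i <- [seq i <- index_enum 'I_n | i != i0])
    h i (Y i w))%R; last by apply/funext => w /=; rewrite /Z big_filter.
  exact: measurable_prod.
have Z0 w : 0 <= (Z w)%:E by rewrite lee_fin prodr_ge0.
have w0 w : (0 <= h i0 (Y i0 w))%R by [].
transitivity (\int[P]_w ((h i0 (Y i0 w))%:E * (Z w)%:E)).
  by apply: eq_integral => w _; rewrite -EFinM /Z (bigD1 i0).
rewrite (layer_cake P (mhY i0) mZ w0 Z0).
have mitv : measurable (`[0%R, +oo[%classic : set R) by exact: measurable_itv.
have mlev u : measurable [set x : R | (u < h i0 x)%R].
  by apply: measurable_bool_set; exact: measurable_fun_ltr.
transitivity (\int[lebesgue_measure]_(u in `[0%R, +oo[)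
    (P [set w | (u < h i0 (Y i0 w))%R] *
     \prod_(i < n | i != i0) \int[P]_w (h i (Y i w))%:E)).
  apply: eq_integral => u _.
  (* Coordinate [i0] becomes the indicator of its layer, so every coordinate from [m] on is an
     indicator and the induction hypothesis applies. *)
  pose hu i := if i == i0 then \1_[set x : R | (u < h i0 x)%R] else h i.
  have mhu i : measurable_fun [set: R] (hu i).
    by rewrite /hu; case: eqP => // _; exact: measurable_indic.
  have hu0 i x : (0 <= hu i x)%R by rewrite /hu; case: eqP.
  have huind (i : 'I_n) : (m <= i)%N ->
      exists2 B : set R, measurable B & hu i = \1_B.
    rewrite /hu; case: eqP => [_ _|/eqP ii0 mi]; first by eexists; first exact: mlev.
    apply: hind; rewrite ltn_neqAle mi andbT; apply: contraNneq ii0 => im.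
    by apply/eqP/val_inj.
  have := IH hu mhu hu0 huind; rewrite [RHS](bigD1 i0)//=.
  rewrite (_ : \prod_(i < n | i != i0) \int[P]_w (hu i (Y i w))%:E =
      \prod_(i < n | i != i0) \int[P]_w (h i (Y i w))%:E); last first.
    by apply: eq_bigr => i /negbTE ii0; rewrite /hu ii0.
  rewrite (_ : \int[P]_w (hu i0 (Y i0 w))%:E = P [set w | (u < h i0 (Y i0 w))%R]).
    move=> <-; apply: eq_integral => w _; rewrite -EFinM (bigD1 i0)//= /hu eqxx.
    congr (_ * _)%:E%R; apply: eq_bigr => i /negbTE ii0.
    by rewrite ii0.
  rewrite /hu eqxx.
  rewrite (_ : (fun w => _) = fun w => (\1_[set w | (u < h i0 (Y i0 w))%R] w)%:E)//.
  rewrite integral_indic ?setIT//; apply: measurable_bool_set.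
  exact: measurable_fun_ltr.
rewrite ge0_integralZr//.
- by rewrite -integral_superlevel// [RHS](bigD1 i0).
- by apply: measurable_funTS; exact: measurable_superlevel.
- apply: prode_ge0 => i _; apply: integral_ge0 => w _; by rewrite lee_fin.
Qed.

End independence.

(** Equal laws thereby give equal integrals, even across two probability spaces. *)
Lemma eq_integral_superlevel (R : realType) (d d' : measure_display)
    (T : measurableType d) (T' : measurableType d')
    (m : {sigma_finite_measure set T -> \bar R})
    (m' : {sigma_finite_measure set T' -> \bar R}) (w : T -> R) (w' : T' -> R) :
  measurable_fun [set: T] w -> measurable_fun [set: T'] w' ->
  (forall x, 0 <= w x)%R -> (forall x, 0 <= w' x)%R ->
  (forall u : R, m [set x | (u < w x)%R] = m' [set x | (u < w' x)%R]) ->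
  \int[m]_x (w x)%:E = \int[m']_x (w' x)%:E.
Proof.
move=> mw mw' w0 w'0 E; rewrite !integral_superlevel//.
by apply: eq_integral => u _.
Qed.

(** Boxes are stable under intersection, so they are the generating family on which two laws need to
    be compared. *)
Lemma measurable_boxes (R : realType) (n : nat) :
  @measurable _ (n.-tuple R) = <<s [set A : set (n.-tuple R) |
    exists2 B : 'I_n -> set R, (forall i, measurable (B i)) &
      A = [set t | forall i, B i (tnth t i)]] >>.
Proof.
set G := mkset _; apply/seteqP; split; last first.
  apply: smallest_sub; first exact: sigma_algebra_measurable.
  move=> _ [B mB ->]; rewrite (_ : mkset _ =
    \bigcap_(i in [set: 'I_n]) ((fun t : n.-tuple R => tnth t i) @^-1` B i)).
    apply: fin_bigcap_measurable => // i _.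
    by rewrite -[X in measurable X]setTI; exact: measurable_tnth.
  by apply/seteqP; split => t /= h i; [move=> _; exact: h|exact: h].
apply: smallest_sub; first exact: smallest_sigma_algebra.
move=> A; rewrite -bigcup_seq => -[i _ [C mC <-]]; rewrite setTI.
apply: sub_sigma_algebra; exists (fun j => if j == i then C else setT).
  by move=> j; case: eqP.
apply/seteqP; split => t /= h; last by have := h i; rewrite eqxx.
by move=> j; case: eqP => [->|].
Qed.

(** * Sign symmetry of the two laws, and moments of the uniform law *)

Section flip_laws.
Variables (R : realType) (n : nat).
Variables (d : measure_display) (T : measurableType d) (P : probability T R).

Lemma law_box_unique (X X' : T -> n.-tuple R) :
  measurable_fun [set: T] X -> measurable_fun [set: T] X' ->
  (forall B : 'I_n -> set R, (forall i, measurable (B i)) ->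
    P [set w | forall i, B i (tnth (X w) i)] =
    P [set w | forall i, B i (tnth (X' w) i)]) ->
  forall A, measurable A -> P (X @^-1` A) = P (X' @^-1` A).
Proof.
move=> mX mX' box A mA.
pose m1 := measure_function_pushforward__canonical__measure_function_Measure P mX.
pose m2 := measure_function_pushforward__canonical__measure_function_Measure P mX'.
apply: (@measure_unique _ R _ _ (fun=> setT) (measurable_boxes R n)
  _ _ _ m1 m2) => //.
- move=> _ _ [B mB ->] [C mC ->]; exists (fun i => B i `&` C i).
    by move=> i; exact: measurableI.
  apply/seteqP; split => t /=; first by move=> [hB hC] i.
  by move=> h; split => i; have [] := h i.
- move=> _; exists (fun=> setT) => //.
  by apply/seteqP; split.
- by apply/seteqP; split => // t _; exists 0%N.
- by move=> _ [B mB ->]; exact: box.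
- move=> _; rewrite /m1/= /pushforward preimage_setT probability_setT.
  by rewrite ltry.
Qed.

(** Flipping replaces some sides of a box by their reflections; independence and the symmetry of
    each marginal leave the probability of the box unchanged. *)
Lemma independent_flip (Y : 'I_n -> {RV P >-> R}) (e : 'I_n -> bool)
    (H : n.-tuple R -> R) :
  mutually_independent Y ->
  (forall i (B : set R), measurable B ->
    P (Y i @^-1` (-%R @^-1` B)) = P (Y i @^-1` B)) ->
  measurable_fun [set: n.-tuple R] H -> (forall t, 0 <= H t)%R ->
  \int[P]_w (H (tuple_flip e [tuple Y i w | i < n]))%:E =
  \int[P]_w (H [tuple Y i w | i < n])%:E.
Proof.
move=> indepY symY mH H0.
have mY : measurable_fun [set: T] (fun w => [tuple Y i w | i < n] : n.-tuple R).
  apply/measurable_fun_tnthP => i.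
  rewrite (_ : _ \o _ = Y i); first exact: measurable_funPT.
  by apply/funext => w /=; rewrite tnth_mktuple.
have mYe : measurable_fun [set: T] (fun w => tuple_flip e [tuple Y i w | i < n]).
  by apply: measurableT_comp => //; exact: measurable_tuple_flip.
apply: eq_integral_superlevel => //.
- exact: measurableT_comp mH mYe.
- exact: measurableT_comp mH mY.
move=> u; have mu : measurable [set t | (u < H t)%R].
  by apply: measurable_bool_set; exact: measurable_fun_ltr.
apply: (law_box_unique mYe mY _ mu) => B mB.
have mN (C : set R) : measurable C -> measurable (-%R @^-1` C).
  by move=> mC; rewrite -[X in measurable X]setTI; exact: oppr_measurable.
pose Be i := if e i then -%R @^-1` B i else B i.
have mBe i : measurable (Be i) by rewrite /Be; case: (e i) => //; exact: mN.
transitivity (P [set w | forall i, Be i (Y i w)]).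
  congr (P _); apply/seteqP; split => w /= h i; move: (h i);
  by rewrite !tnth_mktuple /Be; case: (e i).
rewrite independent_box//.
transitivity (\prod_(i < n) P (Y i @^-1` B i)).
  by apply: eq_bigr => i _; rewrite /Be; case: (e i) => //; exact: symY.
rewrite -independent_box//; congr (P _).
by apply/seteqP; split => w /= h i; move: (h i); rewrite tnth_mktuple.
Qed.

Variables (F : 'I_n -> R -> \bar R) (X : {RV P >-> n.-tuple R}).
Hypotheses (hF : forall i, young_function (F i))
  (hX : uniformly_distributed X (orlicz_ball F)).
Let K := orlicz_ball F.

Let mK : measurable K.
Proof. exact: (measurable_orlicz_level 1 hF). Qed.

Let mX : measurable_fun [set: T] (X : T -> n.-tuple R).
Proof. exact: measurable_funPT. Qed.

(* Division in [\bar R] sends [0 / 0] and [+oo / +oo] to [0], so having total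
   mass one forces [0 < vol K < +oo]. *)
Lemma uniform_volume : exists2 v : R, (0 < v)%R & lebesgue_tuple K = v%:E.
Proof.
have := hX measurableT; rewrite setTI -/K.
rewrite /distribution /pushforward preimage_setT probability_setT.
have : 0 <= lebesgue_tuple K by exact: measure_ge0.
case: (lebesgue_tuple K) => [v v0| _|//].
  move: v0; rewrite lee_fin le_eqVlt => /orP[/eqP <-|v0 _]; last by exists v.
  by rewrite mul0e => /(congr1 fine)/eqP; rewrite oner_eq0.
by rewrite invey mule0 => /(congr1 fine)/eqP; rewrite oner_eq0.
Qed.

(** Compared by layers: for [u >= 0] the superlevel set of [H * \1_K] is the part in [K] of the
    superlevel set of [H]. *)
Lemma uniform_integral (v : R) (H : n.-tuple R -> R) :
  (0 < v)%R -> lebesgue_tuple K = v%:E ->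
  measurable_fun [set: n.-tuple R] H -> (forall t, 0 <= H t)%R ->
  \int[P]_w (H (X w))%:E =
  \int[@lebesgue_tuple R n]_t (H t * \1_K t)%:E * (v^-1)%:E.
Proof.
move=> v0 Kv mH H0.
have mHX : measurable_fun [set: T] (H \o X) by exact: measurableT_comp mH mX.
have mHK : measurable_fun [set: n.-tuple R] (fun t => H t * \1_K t)%R.
  by apply: measurable_funM => //; exact: measurable_indic.
have HK0 t : (0 <= H t * \1_K t)%R by rewrite mulr_ge0.
rewrite (integral_superlevel P mHX)//; last by move=> w /=.
rewrite integral_superlevel// -ge0_integralZr//; first last.
- by rewrite lee_fin invr_ge0 ltW.
- by apply: measurable_funTS; exact: measurable_superlevel.
apply: eq_integral => u /set_mem/=; rewrite in_itv/= andbT => u0.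
have mu : measurable [set t | (u < H t)%R].
  by apply: measurable_bool_set; exact: measurable_fun_ltr.
have := hX mu; rewrite -/K Kv inver gt_eqF// => hXu.
transitivity (distribution P X [set t | (u < H t)%R]); first by [].
rewrite hXu; congr (lebesgue_tuple _ * _); apply/seteqP; split => t /=; rewrite indicE.
  by move=> [uH Kt]; rewrite mem_set// mulr1.
have [/set_mem Kt|_] := boolP (t \in K); first by rewrite mulr1.
by rewrite mulr0 ltNge u0.
Qed.

Lemma uniform_flip (e : 'I_n -> bool) (H : n.-tuple R -> R) :
  measurable_fun [set: n.-tuple R] H -> (forall t, 0 <= H t)%R ->
  \int[P]_w (H (tuple_flip e (X w)))%:E = \int[P]_w (H (X w))%:E.
Proof.
move=> mH H0; have [v v0 Kv] := uniform_volume.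
have mHe : measurable_fun [set: n.-tuple R] (fun t => H (tuple_flip e t)).
  by apply: measurableT_comp => //; exact: measurable_tuple_flip.
rewrite (uniform_integral v0 Kv mHe)// (uniform_integral v0 Kv mH)//.
congr (_ * _); rewrite -[RHS](integral_lebesgue_tuple_flip e); first last.
- by move=> t; rewrite lee_fin mulr_ge0.
- apply/measurable_EFinP; apply: measurable_funM => //; exact: measurable_indic.
apply: eq_integral => t _; congr ((_ * _)%R%:E); rewrite !indicE.
have -> // : (t \in K) = (tuple_flip e t \in K).
have absE i : `|tnth (tuple_flip e t) i|%R = `|tnth t i|%R.
  by rewrite tnth_mktuple; case: (e i); rewrite ?normrN.
have sumE : \sum_(i < n) F i `|tnth (tuple_flip e t) i|%R =
    \sum_(i < n) F i `|tnth t i|%R by apply: eq_bigr => i _; rewrite absE.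
apply/idP/idP => /set_mem h; apply/mem_set; move: h;
by rewrite /K /orlicz_ball/= sumE.
Qed.

Lemma uniform_monomial (v : R) (k : 'I_n -> nat) :
  (0 < v)%R -> lebesgue_tuple K = v%:E -> (forall i, ~~ odd (k i)) ->
  \int[P]_w (\prod_(i < n) tnth (X w) i ^+ k i)%:E =
  (2 ^+ n)%:E * iter_slice (fun i => young_dom (F i))
    (fun i => young_real (F i)) k (@step_level R) 1 * (v^-1)%:E.
Proof.
move=> v0 Kv ek; rewrite -integral_orlicz_monomial//.
rewrite (uniform_integral v0 Kv (H := fun t => \prod_(i < n) tnth t i ^+ k i)%R)//.
  exact: measurable_monomial.
by move=> t; exact: monomial_ge0.
Qed.

Lemma uniform_volumeE (v : R) : lebesgue_tuple K = v%:E ->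
  v%:E = (2 ^+ n)%:E * iter_slice (fun i => young_dom (F i))
    (fun i => young_real (F i)) (fun=> 0%N) (@step_level R) 1.
Proof.
move=> <-; rewrite -integral_orlicz_monomial//.
transitivity (\int[@lebesgue_tuple R n]_t (\1_K t)%:E).
  by rewrite integral_indic// setIT.
apply: eq_integral => t _; congr (_%:E).
by rewrite big1 ?mul1r// => i _; rewrite expr0.
Qed.

Lemma uniform_monomial_le (k : 'I_n -> nat) : (forall i, ~~ odd (k i)) ->
  \int[P]_w (\prod_(i < n) tnth (X w) i ^+ k i)%:E <=
  \prod_(i < n) \int[P]_w (tnth (X w) i ^+ k i)%:E.
Proof.
move=> ek; have [v v0 Kv] := uniform_volume.
pose I k := iter_slice (fun i => young_dom (F i))
    (fun i => young_real (F i)) k (@step_level R) 1%R.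
have hD i : profile (young_dom (F i)) (young_real (F i)) by exact: young_profile.
have hS := step_log_concave R.
have I0 j : 0 <= I j.
  exact: level_ge0 (iter_slice_level j hD (lc_level hS)) _.
(* Finiteness of all the slices allows the final division to be carried out in [R]. *)
have Ifin j : I j \is a fin_num.
  rewrite ge0_fin_numE//.
  have [c c0 hc] := iter_slice_le j 1%R hD (lc_level hS).
  apply: le_lt_trans (hc _ (lexx _)) _.
  rewrite -ge0_fin_numE; last by apply: mule_ge0 => //; exact: I0.
  by rewrite fin_numM//; apply: lc_fin; exact: iter_slice_log_concave.
have vE := uniform_volumeE Kv; rewrite -/(I _) in vE.
pose k1 (i j : 'I_n) : nat := if j == i then k j else 0%N.
have ek1 i0 i1 : ~~ odd (k1 i0 i1) by rewrite /k1; case: eqP.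
have margin i : \int[P]_w (tnth (X w) i ^+ k i)%:E =
    (2 ^+ n)%:E * I (k1 i) * (v^-1)%:E.
  rewrite -uniform_monomial//; apply: eq_integral => w _; congr (_%:E).
  rewrite (bigD1 i)//= /k1 eqxx big1 ?mulr1// => l /negbTE ->.
  by rewrite expr0.
rewrite (uniform_monomial v0 Kv ek) -/(I _).
rewrite (eq_bigr _ (fun i _ => margin i)).
have := iter_slice_sub_product k 1%R hD hS; rewrite -!/(I _).
rewrite (eq_bigr (fun i => I (k1 i)))//.
have FE j : I j = (fine (I j))%:E by rewrite fineK.
rewrite FE (FE (fun=> 0%N)) (eq_bigr (fun i => (fine (I (k1 i)))%:E)); last first.
  by move=> i _; rewrite -FE.
rewrite [in X in _ -> _ <= X](eq_bigr (fun i => (2 ^+ n * fine (I (k1 i)) * v^-1)%:E));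
  last by move=> i _; rewrite FE -!EFinM.
rewrite FE in vE; rewrite -!EFinM in vE *; case: vE => vE.
rewrite !prodEFin -EFin_expe -!EFinM !lee_fin => main.
set V := fine (I (fun=> 0%N)) in main vE.
have V0 : (0 < V)%R.
  by move: v0; rewrite vE pmulr_rgt0// exprn_gt0.
(* The factor [2 ^+ n] cancels against the one in [v = 2 ^+ n * V], leaving each moment as a ratio
   of slices. *)
have cE (x : R) : (2 ^+ n * x * v^-1 = x / V)%R.
  by rewrite vE; field; rewrite expf_neq0// gt_eqF.
rewrite cE (eq_bigr (fun i => fine (I (k1 i)) / V)%R); last by move=> i _; rewrite cE.
rewrite big_split/= prodr_const card_ord ler_pdivrMr//.
rewrite exprVn mulrAC ler_pdivlMr ?exprn_gt0//.
by rewrite (mulrC _ V).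
Qed.

End flip_laws.

Unset Implicit Arguments.

Theorem theorem1p5 (R : realType) (n : nat) (K : set (n.-tuple R))
    (hK : generalized_orlicz_ball K) (a : 'I_n -> R)
    (d : measure_display) (T : measurableType d) (P : probability T R)
    (X : {RV P >-> n.-tuple R}) (hX : uniformly_distributed X K)
    (d' : measure_display) (T' : measurableType d') (P' : probability T' R)
    (Xs : 'I_n -> {RV P' >-> R}) (hXs_indep : mutually_independent Xs)
    (hXs_distr : forall i : 'I_n,
      identically_distributed P' P (Xs i) (fun w => tnth (X w) i))
    (p : nat) (hp : (0 < p)%N) (p_even : ~~ odd p) :
  'E_P [fun w => ((\sum_(i < n) a i * tnth (X w) i) ^+ p)%R] <=
  'E_P' [fun w => ((\sum_(i < n) a i * Xs i w) ^+ p)%R].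
Proof.
case: hK => F hF KE; rewrite {}KE in hX.
have mX : measurable_fun [set: T] (X : T -> n.-tuple R) by exact: measurable_funPT.
have mXs i : measurable_fun [set: T'] (Xs i : T' -> R) by exact: measurable_funPT.
have mXi i : measurable_fun [set: T] (fun w => tnth (X w) i).
  exact: measurableT_comp (measurable_tnth i) mX.
pose Y (w : T') : n.-tuple R := [tuple Xs i w | i < n].
have mY : measurable_fun [set: T'] Y.
  apply/measurable_fun_tnthP => i.
  rewrite (_ : _ \o _ = Xs i); first exact: mXs.
  by apply/funext => w /=; rewrite tnth_mktuple.
(* Each [Xs i] inherits its symmetry from coordinate [i] of [X]; flipping all coordinates at once
   suffices to see it. *)
have symXs i (B : set R) : measurable B ->
    P' (Xs i @^-1` (-%R @^-1` B)) = P' (Xs i @^-1` B).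
  move=> mB; have mNB : measurable (-%R @^-1` B).
    by rewrite -[X in measurable X]setTI; exact: oppr_measurable.
  have := hXs_distr i _ mNB; have := hXs_distr i _ mB.
  rewrite /pushforward => -> ->.
  pose H (t : n.-tuple R) : R := \1_B (tnth t i).
  have mH : measurable_fun [set: n.-tuple R] H.
    exact: measurableT_comp (@measurable_indic _ _ R setT B mB) (measurable_tnth i).
  have mpre (C : set R) : measurable C -> measurable ((fun w => tnth (X w) i) @^-1` C).
    by move=> mC; rewrite -[X in measurable X]setTI; exact: mXi.
  have := uniform_flip hF hX (fun=> true) mH (fun t => ler0n _ _).
  rewrite (_ : \int[P]_w (H (X w))%:E = P ((fun w => tnth (X w) i) @^-1` B)).
    move=> <-; transitivity
      (\int[P]_w (\1_((fun w => tnth (X w) i) @^-1` (-%R @^-1` B)) w)%:E).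
      by rewrite integral_indic ?setIT//; exact: mpre.
    by apply: eq_integral => w _; rewrite /H tnth_mktuple.
  transitivity (\int[P]_w (\1_((fun w => tnth (X w) i) @^-1` B) w)%:E) => //.
  by rewrite integral_indic ?setIT//; exact: mpre.
rewrite !expectation.unlock.
rewrite (expectation_even_words a p_even mX); last first.
  by move=> e H mH H0; exact: uniform_flip.
rewrite [leRHS](_ : _ =
    \int[P']_w ((\sum_(i < n) a i * tnth (Y w) i) ^+ p)%:E); last first.
  apply: eq_integral => w _; congr (_ ^+ _)%R%:E; apply: eq_bigr => i _.
  by rewrite tnth_mktuple.
rewrite (expectation_even_words a p_even mY); last first.
  by move=> e H mH H0; exact: independent_flip.
(* Term by term: the coefficient is a product of even powers of the [a i], hence nonnegative. *)
apply: lee_sum => phi /forallP phi_even; apply: lee_wpmul2l.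
  by rewrite lee_fin; exact: monomial_ge0.
apply: le_trans (uniform_monomial_le hF hX phi_even) _.
pose g i (x : R) : R := (x ^+ multiplicity phi i)%R.
have mg i : measurable_fun [set: R] (g i) by exact: measurable_funX.
have g0 i x : (0 <= g i x)%R by exact: exprn_even_ge0.
(* What remains is an equality: independence factors the moment of [Y], and each factor depends only
   on a marginal law. *)
rewrite le_eqVlt; apply/orP; left; apply/eqP.
transitivity (\prod_(i < n) \int[P']_w (g i (Xs i w))%:E); last first.
  rewrite -independent_integral_prod//; apply: eq_integral => w _.
  by congr (_%:E); apply: eq_bigr => i _; rewrite tnth_mktuple.
apply: eq_bigr => i _; apply/esym/eq_integral_superlevel.
- exact: measurableT_comp (mg i) (mXs i).
- exact: measurableT_comp (mg i) (mXi i).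
- by move=> w; exact: g0.
- by move=> w; exact: g0.
move=> u; apply: (hXs_distr i [set x | (u < g i x)%R]).
by apply: measurable_bool_set; exact: measurable_fun_ltr.
Qed.
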